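(* Let $B\xleftarrow{\rho}A$ be a 1-arrow in a 2-$C^*$-category closed under projections, direct sums and conjugation, and let $R_\rho,\bar R_\rho$ be a solution of the conjugation equations for $\rho$. For $\omega\in\Omega_A$ let $\mathrm{End}(\rho)_\omega$ be the Hilbert space obtained by separation and completion of $\mathrm{End}(\rho)$ with respect to $(T,S)\mapsto \langle T,S\rangle(\omega)$, where $\langle T,S\rangle=R_\rho^*\circ(1_{\bar\rho}\otimes(S^*\circ T))\circ R_\rho\in\mathrm{End}(\iota_A)\cong C(\Omega_A)$, and let $\pi_\omega$ be the GNS representation of $\mathrm{End}(\rho)$ on $\mathrm{End}(\rho)_\omega$ by left multiplication. Then $\mathrm{End}(\rho)$ has the structure of a $C^*$-algebra bundle over $\Omega_A$: the family of $C^*$-algebras $\{\pi_\omega(\mathrm{End}(\rho))\}_{\omega\in\Omega_A}$ with operator norms, together with the set of continuous sections $\Gamma=\{(\pi_\omega(T))_{\omega}:T\in\mathrm{End}(\rho)\}$, is a $C^*$-algebra bundle over $\Omega_A$, and $T\mapsto(\pi_\omega(T))_\omega$ is a bijection of $\mathrm{End}(\rho)$ onto $\Gamma$.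
   Context: A 2-$C^*$-category is a strict 2-category (1-arrows $B\xleftarrow{\rho}A$ composed by $\otimes$, with unit 1-arrows $\iota_A$; 2-arrows $S\in\mathrm{Hom}(\rho,\sigma)$ between parallel 1-arrows, with vertical composition $\circ$, units $1_\rho$, and horizontal composition $\otimes$; $\mathrm{End}(\rho)=\mathrm{Hom}(\rho,\rho)$) such that every $\mathrm{Hom}(\rho,\sigma)$ is a complex Banach space, compositions are bilinear, there is an antilinear involution $*:\mathrm{Hom}(\rho,\sigma)\to\mathrm{Hom}(\sigma,\rho)$ with $(S\circ T)^*=T^*\circ S^*$ and $(S\otimes T)^*=S^*\otimes T^*$, $\|T\circ S\|\le\|T\|\|S\|$, $\|S^*\circ S\|=\|S\|^2$, and $S^*\circ S$ is positive in $\mathrm{End}(\rho)$ for $S\in\mathrm{Hom}(\rho,\sigma)$. Then $\mathrm{End}(\rho)$ is a unital $C^*$-algebra, and $\mathrm{End}(\iota_A)$ is commutative, identified with $C(\Omega_A)$, $\Omega_A$ compact Hausdorff; units are not assumed simple. Closed under projections: for each projection $P\in\mathrm{End}(\rho)$ there are a 1-arrow $\rho_P$ and $W\in\mathrm{Hom}(\rho_P,\rho)$ with $W^*\circ W=1_{\rho_P}$, $W\circ W^*=P$. Closed under direct sums: for parallel $\rho_1,\rho_2$ there are $\rho$ and $W_i\in\mathrm{Hom}(\rho_i,\rho)$ with $W_i^*\circ W_j=\delta_{ij}1_{\rho_i}$, $W_1\circ W_1^*+W_2\circ W_2^*=1_\rho$. Closed under conjugation: for each $B\xleftarrow{\rho}A$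 there are $A\xleftarrow{\bar\rho}B$ and $R_\rho\in\mathrm{Hom}(\iota_A,\bar\rho\otimes\rho)$, $\bar R_\rho\in\mathrm{Hom}(\iota_B,\rho\otimes\bar\rho)$ (a solution of the conjugation equations) with $(\bar R_\rho^*\otimes1_\rho)\circ(1_\rho\otimes R_\rho)=1_\rho$, $(R_\rho^*\otimes1_{\bar\rho})\circ(1_{\bar\rho}\otimes\bar R_\rho)=1_{\bar\rho}$. A Banach bundle over a compact Hausdorff space $\Omega$ is a family of Banach spaces $\{E_\omega,\|\cdot\|^\omega\}_{\omega\in\Omega}$ with a set $\Gamma\subset\prod_\omega E_\omega$ (continuous sections) such that: (i) $\Gamma$ is a linear subspace; (ii) for all $\omega$, $\{S_{|\omega}:S\in\Gamma\}$ is dense in $E_\omega$; (iii) for all $S\in\Gamma$, $\omega\mapsto\|S_{|\omega}\|^\omega$ is continuous; (iv) if $X\in\prod_\omega E_\omega$ is such that for all $\omega$ and $\epsilon>0$ there is $S\in\Gamma$ with $\|X_{|\omega'}-S_{|\omega'}\|^{\omega'}<\epsilon$ for $\omega'$ in a neighbourhood of $\omega$, then $X\in\Gamma$. It is a $C^*$-algebra bundle if the $E_\omega$ are $C^*$-algebras and $\Gamma$ is closed under (fibrewise) multiplication and $*$. *)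

(* Defs.v *)
From HB Require Import structures.
From mathcomp Require Import all_boot all_order all_algebra ring_quotient.
From mathcomp Require Import all_classical all_reals all_analysis.
From mathcomp Require Import complex.
From mathcomp Require Import ring lra.

Set Implicit Arguments.
Unset Strict Implicit.
Unset Printing Implicit Defensive.
Import numFieldNormedType.Exports.
Import Order.TTheory GRing.Theory Num.Theory.
Local Open Scope classical_set_scope.
Local Open Scope ring_scope.
Local Open Scope complex_scope.
Local Open Scope quotient_scope.

(* The norm of a [normedModType R[i]] takes its values in [R[i]]; [rnorm] is the
   same norm with values in [R]. *)
Definition rnorm {R : realType} {V : normedZmodType R[i]} (x : V) : R :=
  complex.Re `|x|.

Lemma rnormE {R : realType} {V : normedZmodType R[i]} (x : V) :
  `|x| = (rnorm x)%:C.
Proof. by rewrite /rnorm RRe_real // normr_real. Qed.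

Lemma rnormCE {R : realType} (a : R[i]) :
  rnorm a = Num.sqrt (complex.Re a ^+ 2 + complex.Im a ^+ 2).
Proof. by rewrite /rnorm normc_def. Qed.

Section semi_inner_product.
Context {R : realType} {V : lmodType R[i]}.

(* Forms are linear in the first argument and antilinear in the second. *)
Record semi_inner_product := SemiInnerProduct {
  sip_form :> {hermitian V for false & @conjc R};
  sip_ge0 : forall x, 0 <= sip_form x x }.

Variable Q : semi_inner_product.

Definition seminorm (x : V) : R := Num.sqrt (complex.Re (Q x x)).

Let r x y : R := complex.Re (Q x y).

Lemma sipC x y : Q x y = conjc (Q y x).
Proof. by rewrite hermC expr0 mul1r. Qed.

Lemma sipDl x y z : Q (x + y) z = Q x z + Q y z.
Proof. exact: linearDl. Qed.

Lemma sipZl a x y : Q (a *: x) y = a * Q x y.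
Proof. exact: linearZl_LR. Qed.

Lemma sipZr a x y : Q x (a *: y) = conjc a * Q x y.
Proof. by rewrite sipC sipZl rmorphM /= [Q x y]sipC. Qed.

Lemma rip_sym x y : r x y = r y x.
Proof. by rewrite /r sipC; case: (Q y x). Qed.

Lemma ripDl x y z : r (x + y) z = r x z + r y z.
Proof. by rewrite /r sipDl; case: (Q x z); case: (Q y z). Qed.

Lemma ripZl a x y : r (a *: x) y =
  complex.Re a * r x y - complex.Im a * complex.Im (Q x y).
Proof. by rewrite /r sipZl; case: a => a b; case: (Q x y). Qed.

Lemma rip_Im x y : complex.Im (Q x y) = r x ('i *: y).
Proof. by rewrite /r sipZr; case: (Q x y) => a b /=; ring. Qed.

Lemma ripRl (a : R) x y : r (a%:C *: x) y = a * r x y.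
Proof. by rewrite ripZl /= mul0r subr0. Qed.

Lemma rip_ge0 x : 0 <= r x x.
Proof.
have := sip_ge0 Q x; rewrite /r; case: (Q x x) => a b.
by rewrite lecE /= => /andP[].
Qed.

Lemma seminorm_ge0 x : 0 <= seminorm x. Proof. exact: sqrtr_ge0. Qed.

Lemma seminorm_sqr x : seminorm x ^+ 2 = r x x.
Proof. by rewrite sqr_sqrtr // rip_ge0. Qed.

Lemma rip_comb (a b : R) x y : r (a%:C *: x + b%:C *: y) (a%:C *: x + b%:C *: y)
  = a ^+ 2 * r x x + 2 * a * b * r x y + b ^+ 2 * r y y.
Proof.
rewrite ripDl !ripRl ![r _ (_ + _)]rip_sym !ripDl !ripRl (rip_sym y x); ring.
Qed.

Lemma rip_CS x y : `|r x y| <= seminorm x * seminorm y.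
Proof.
rewrite -ler_sqr ?nnegrE ?mulr_ge0 ?seminorm_ge0 //.
rewrite exprMn !seminorm_sqr real_normK ?num_real //.
set X := r x x; set Y := r y y; set Z := r x y.
have X0 : 0 <= X := rip_ge0 x.
have H a b : 0 <= a ^+ 2 * X + 2 * a * b * Z + b ^+ 2 * Y.
  by rewrite -rip_comb rip_ge0.
have : 0 <= Y := rip_ge0 y.
rewrite le_eqVlt => /orP[/eqP Y0|Y0].
  rewrite -Y0 mulr0; have [->|Z0] := eqVneq Z 0; first by rewrite expr0n.
  have := H 1 (- ((X + 1) / (2 * Z))); rewrite -Y0 mulr0 addr0.
  have -> : 1 ^+ 2 * X + 2 * 1 * - ((X + 1) / (2 * Z)) * Z = -1 by field.
  by rewrite ler0N1.
have := H Y (- Z).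
have -> : Y ^+ 2 * X + 2 * Y * - Z * Z + (- Z) ^+ 2 * Y = Y * (X * Y - Z ^+ 2).
  by ring.
by rewrite pmulr_rge0 // subr_ge0.
Qed.

Lemma seminormD x y : seminorm (x + y) <= seminorm x + seminorm y.
Proof.
rewrite -ler_sqr ?nnegrE ?addr_ge0 ?seminorm_ge0 // seminorm_sqr.
have := rip_comb 1 1 x y; rewrite !scale1r => ->.
rewrite sqrrD !seminorm_sqr !expr1n !mul1r !mulr1.
have := rip_CS x y; have := ler_norm (r x y).
rewrite -mulr_natl; lra.
Qed.

Lemma seminormZ a x : seminorm (a *: x) = rnorm a * seminorm x.
Proof.
rewrite rnormCE /seminorm -sqrtrM ?addr_ge0 ?sqr_ge0 //; congr Num.sqrt.
rewrite sipZl sipZr.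
have : 0 <= Q x x by exact: sip_ge0.
case: (Q x x) => c d; rewrite lecE /= => /andP[/eqP -> _].
by case: a => a b /=; ring.
Qed.

Lemma seminorm0 : seminorm 0 = 0.
Proof. by rewrite -(scale0r 0) seminormZ /rnorm normr0 /= mul0r. Qed.

Lemma seminormN x : seminorm (- x) = seminorm x.
Proof.
by rewrite -scaleN1r seminormZ /rnorm normrN1 /= mul1r.
Qed.

Lemma seminormB x y : seminorm (x - y) = seminorm (y - x).
Proof. by rewrite -seminormN opprB. Qed.

Lemma ler_seminormB x y : seminorm x <= seminorm (x - y) + seminorm y.
Proof. by rewrite -{1}(subrK y x) seminormD. Qed.

Lemma ripBl x y z : r (x - y) z = r x z - r y z.
Proof. by rewrite -scaleN1r ripDl (_ : -1 = (-1)%:C) ?ripRl ?mulN1r // rmorphN. Qed.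

(* Separation and completion of [V]: Cauchy sequences for the seminorm modulo
   null sequences. *)
Definition cauchy_sequences : {pred nat -> V} := fun u =>
  `[< forall e : R, 0 < e -> exists N, forall m n,
       (N <= m)%N -> (N <= n)%N -> seminorm (u m - u n) < e >].

Lemma cauchy_submod_closed : submod_closed cauchy_sequences.
Proof.
split.
  apply/asboolP => e e0; exists 0%N => m n _ _.
  by rewrite subr0 seminorm0.
move=> a u v /asboolP uc /asboolP vc; apply/asboolP => e e0.
have a0 : 0 < rnorm a + 1.
  by rewrite ltr_wpDl // rnormCE sqrtr_ge0.
have [|N1 H1] := uc (e / 2 / (rnorm a + 1)).
  by rewrite !divr_gt0.
have [|N2 H2] := vc (e / 2); first by rewrite divr_gt0.
exists (maxn N1 N2) => m n; rewrite !geq_max => /andP[m1 m2] /andP[n1 n2].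
have -> : (a *: u + v) m - (a *: u + v) n = a *: (u m - u n) + (v m - v n).
  by rewrite scalerBr [in LHS]opprD addrACA.
apply: le_lt_trans (seminormD _ _) _; rewrite seminormZ [e]splitr.
apply: ler_ltD (H2 _ _ m2 n2).
have := H1 _ _ m1 n1; rewrite ltr_pdivlMr // => /ltW; apply: le_trans.
by rewrite mulrC ler_wpM2l ?seminorm_ge0 // lerDl.
Qed.

HB.instance Definition _ :=
  GRing.isSubmodClosed.Build R[i] (nat -> V) cauchy_sequences cauchy_submod_closed.

Record cauchy_seq := CauchySeq {
  cauchy_val :> nat -> V; _ : cauchy_val \in cauchy_sequences }.

HB.instance Definition _ := [isSub for cauchy_val].
HB.instance Definition _ := [Choice of cauchy_seq by <:].
HB.instance Definition _ := [SubChoice_isSubLmodule of cauchy_seq by <:].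

Definition null_sequences : {pred cauchy_seq} := fun u =>
  `[< (fun n => seminorm (u n)) @ \oo --> (0 : R) >].


Implicit Types u v w : cauchy_seq.

Lemma null_zmod_closed : zmod_closed null_sequences.
Proof.
split=> [|u v /asboolP u0 /asboolP v0]; apply/asboolP.
  apply: cvg_near_cst; near=> n => /=; exact: seminorm0.
apply: (@squeeze_cvgr _ _ _ _ (cst 0)
  (fun n => seminorm (u n) + seminorm (v n))).
- near=> n; rewrite seminorm_ge0 /=.
  by apply: le_trans (seminormD _ _) _; rewrite seminormN.
- exact: cvg_cst.
- by rewrite -[0]addr0; apply: cvgD.
Unshelve. all: by end_near. Qed.

HB.instance Definition _ :=
  GRing.isZmodClosed.Build cauchy_seq null_sequences null_zmod_closed.

Definition completion : Type := Quotient.quot null_sequences.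

HB.instance Definition _ := EqQuotient.on completion.
HB.instance Definition _ := Choice.on completion.
HB.instance Definition _ := GRing.Zmodule.on completion.

Lemma null_scale a u : u \in null_sequences -> a *: u \in null_sequences.
Proof.
move=> /asboolP u0; apply/asboolP.
rewrite -(mulr0 (rnorm a)).
rewrite (_ : (fun n => _) = (fun n => rnorm a * seminorm (u n))).
  exact: cvgMr.
by apply/funext => n; rewrite -seminormZ.
Qed.

Lemma pi_eq u v : u - v \in null_sequences -> \pi_completion u = \pi_completion v.
Proof. by move=> H; apply/eqP; rewrite -(Quotient.idealrBE). Qed.

Lemma eq_pi u v : \pi_completion u = \pi_completion v -> u - v \in null_sequences.
Proof. by move=> H; rewrite Quotient.idealrBE; apply/eqP. Qed.

Lemma pi_add u v : \pi_completion (u + v) = \pi_completion u + \pi_completion v.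
Proof. by rewrite !piE. Qed.

Definition completion_scale a (x : completion) : completion :=
  \pi_completion (a *: repr x).

Lemma pi_scale a u : completion_scale a (\pi_completion u) = \pi_completion (a *: u).
Proof.
apply: pi_eq; rewrite -scalerBr; apply: null_scale; apply: eq_pi.
by rewrite reprK.
Qed.

Lemma completion_surj (x : completion) : exists u, x = \pi_completion u.
Proof. by exists (repr x); rewrite reprK. Qed.

Lemma completion_scaleA a b x :
  completion_scale a (completion_scale b x) = completion_scale (a * b) x.
Proof. by have [u ->] := completion_surj x; rewrite !pi_scale scalerA. Qed.

Lemma completion_scale1 : left_id 1 completion_scale.
Proof. by move=> x; have [u ->] := completion_surj x; rewrite pi_scale scale1r. Qed.

Lemma completion_scaleDr : right_distributive completion_scale +%R.
Proof.
move=> a x y; have [u ->] := completion_surj x; have [v ->] := completion_surj y.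
by rewrite -pi_add !pi_scale -pi_add scalerDr.
Qed.

Lemma completion_scaleDl x : {morph completion_scale^~ x : a b / a + b}.
Proof.
move=> a b; have [u ->] := completion_surj x.
by rewrite !pi_scale -pi_add scalerDl.
Qed.

HB.instance Definition _ := GRing.Zmodule_isLmodule.Build R[i] completion
  completion_scaleA completion_scale1 completion_scaleDr completion_scaleDl.

Lemma piZ a u : \pi_completion (a *: u) = a *: \pi_completion u.
Proof. by rewrite -pi_scale. Qed.

Lemma cauchy_bounded u : exists2 M : R, 0 < M & exists N, forall n,
  (N <= n)%N -> seminorm (u n) <= M.
Proof.
have /asboolP /(_ 1 ltr01)[N HN] := valP u.
exists (1 + seminorm (u N)); first by rewrite ltr_pwDl // seminorm_ge0.
exists N => n Nn; apply: le_trans (ler_seminormB _ (u N)) _.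
by rewrite lerD2r ltW // HN.
Qed.

Let rseq u v : nat -> R := fun n => r (u n) (v n).

Lemma rseq_cvg u v : cvgn (rseq u v).
Proof.
apply/cauchy_cvgP/cauchy_exP => e e0.
have [M1 M10 [N1 H1]] := cauchy_bounded u.
have [M2 M20 [N2 H2]] := cauchy_bounded v.
have /asboolP /(_ (e / 2 / M2))[|N3 H3] := valP u; first by rewrite !divr_gt0.
have /asboolP /(_ (e / 2 / M1))[|N4 H4] := valP v; first by rewrite !divr_gt0.
pose N := maxn (maxn N1 N2) (maxn N3 N4).
exists (rseq u v N); exists N => // n /= Nn.
have /and4P[n1 n2 n3 n4] : [&& N1 <= n, N2 <= n, N3 <= n & N4 <= n]%N.
  by move: Nn; rewrite !geq_max -andbA.
have /and4P[m1 m2 m3 m4] : [&& N1 <= N, N2 <= N, N3 <= N & N4 <= N]%N.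
  by move: (leqnn N); rewrite {1}/N !geq_max -andbA.
rewrite /ball /= /rseq.
have -> : r (u N) (v N) - r (u n) (v n) =
    r (u N - u n) (v N) + r (v N - v n) (u n).
  by rewrite !ripBl (rip_sym (v N)) (rip_sym (v n)); ring.
apply: le_lt_trans (ler_normD _ _) _; rewrite [e]splitr; apply: ltrD.
- apply: le_lt_trans (rip_CS _ _) _.
  apply: (@le_lt_trans _ _ (seminorm (u N - u n) * M2)).
    by rewrite ler_wpM2l ?seminorm_ge0 // H2.
  by rewrite -ltr_pdivlMr // H3.
- apply: le_lt_trans (rip_CS _ _) _.
  apply: (@le_lt_trans _ _ (seminorm (v N - v n) * M1)).
    by rewrite ler_wpM2l ?seminorm_ge0 // H1.
  by rewrite -ltr_pdivlMr // H4.
Qed.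

Let L u v : R := limn (rseq u v).

Lemma L_cvg u v : rseq u v @ \oo --> L u v.
Proof. exact: rseq_cvg. Qed.

Lemma L_sym u v : L u v = L v u.
Proof.
by rewrite /L (_ : rseq u v = rseq v u) //; apply/funext => n; exact: rip_sym.
Qed.

Lemma LDl u v w : L (u + v) w = L u w + L v w.
Proof.
apply/cvg_lim => //; rewrite (_ : rseq _ _ = rseq u w \+ rseq v w).
  by apply: cvgD; exact: L_cvg.
by apply/funext => n; rewrite /rseq /= -ripDl.
Qed.

Lemma LZl a u v :
  L (a *: u) v = complex.Re a * L u v - complex.Im a * L u ('i *: v).
Proof.
apply/cvg_lim => //; rewrite (_ : rseq _ _ =
  complex.Re a \*o rseq u v \- complex.Im a \*o rseq u ('i *: v)).
  by apply: cvgB; apply: cvgMr; exact: L_cvg.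
by apply/funext => n; rewrite /rseq /= -rip_Im -ripZl.
Qed.

Lemma L_i u v : L u ('i *: v) = - L v ('i *: u).
Proof.
apply/cvg_lim => //; rewrite (_ : rseq _ _ = \- rseq v ('i *: u)).
  by apply: cvgN; exact: L_cvg.
apply/funext => n; rewrite /rseq /= -!rip_Im [Q (u n) _]sipC.
by case: (Q _ _).
Qed.

Lemma L_null u v : u \in null_sequences -> L u v = 0.
Proof.
move=> /asboolP u0; have [M M0 [N HN]] := cauchy_bounded v.
apply/cvg_lim => //; apply/norm_cvg0P.
apply: (@squeeze_cvgr _ _ _ _ (cst 0) (fun n => seminorm (u n) * M)).
- exists N => // n /= Nn; rewrite normr_ge0 /=.
  by apply: le_trans (rip_CS _ _) _; rewrite ler_wpM2l ?seminorm_ge0 // HN.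
- exact: cvg_cst.
- by rewrite -(mul0r M); apply: cvgMl.
Qed.

Let form u v : R[i] := L u v +i* L u ('i *: v).

Lemma formC u v : form u v = conjc (form v u).
Proof. by rewrite /form L_sym L_i. Qed.

Lemma formDl u v w : form (u + v) w = form u w + form v w.
Proof. by rewrite /form !LDl. Qed.

Lemma formZl a u v : form (a *: u) v = a * form u v.
Proof.
rewrite /form !LZl (_ : L u ('i *: ('i *: v)) = - L u v).
  by case: a => a b; apply/eqP; rewrite eq_complex /=; apply/andP; split; apply/eqP; ring.
rewrite scalerA (_ : 'i * 'i = -1); last by rewrite -expr2 sqr_i.
rewrite scaleN1r !(L_sym u) -scaleN1r LZl /=; ring.
Qed.

Lemma form_null u v : u \in null_sequences -> form u v = 0.
Proof. by move=> u0; rewrite /form !L_null. Qed.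

Definition completion_form (x y : completion) : R[i] := form (repr x) (repr y).

Lemma form_pil u v w : u - v \in null_sequences -> form u w = form v w.
Proof. by move=> uv; rewrite -(subrK v u) formDl form_null ?add0r. Qed.

Lemma completion_form_pi u v :
  completion_form (\pi_completion u) (\pi_completion v) = form u v.
Proof.
rewrite /completion_form (@form_pil _ u); last first.
  by apply: eq_pi; rewrite reprK.
rewrite formC (@form_pil _ v) -?formC //.
by apply: eq_pi; rewrite reprK.
Qed.

Lemma completion_formC x y : completion_form x y = conjc (completion_form y x).
Proof. exact: formC. Qed.

Lemma completion_form_linearl y : linear_for *%R (completion_form^~ y).
Proof.
move=> a x z; have [u ->] := completion_surj x; have [v ->] := completion_surj z.
have [w ->] := completion_surj y.
by rewrite -piZ -pi_add !completion_form_pi formDl formZl.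
Qed.

Lemma completion_form_linearr x :
  linear_for (@conjc R \; *%R) (completion_form x).
Proof.
move=> a y z; rewrite completion_formC completion_form_linearl.
rewrite rmorphD rmorphM /= [completion_form x y]completion_formC.
by rewrite [completion_form x z]completion_formC.
Qed.

HB.instance Definition _ := bilinear_isBilinear.Build R[i] completion completion
  R[i] *%R (@conjc R \; *%R) completion_form
  (completion_form_linearl, completion_form_linearr).

Lemma completion_form_herm x y :
  completion_form x y = (-1) ^+ false * conjc (completion_form y x).
Proof. by rewrite expr0 mul1r completion_formC. Qed.

HB.instance Definition _ := isHermitianSesquilinear.Build R[i] completion
  false (@conjc R) completion_form completion_form_herm.

Lemma completion_form_ge0 x : 0 <= completion_form x x.
Proof.
have [u ->] := completion_surj x; rewrite completion_form_pi /form lecE /=.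
have /eqP := L_i u u; rewrite eq_sym eqNr => /eqP ->; rewrite eqxx /=.
apply: limr_ge; first exact: rseq_cvg.
by near=> n; rewrite /rseq rip_ge0.
Unshelve. all: by end_near. Qed.

Lemma completion_form_eq0 x : completion_form x x = 0 -> x = 0.
Proof.
have [u ->] := completion_surj x; rewrite completion_form_pi /form => - [L0 _].
transitivity (\pi_completion (0 : cauchy_seq)); last by rewrite !piE.
apply: pi_eq; rewrite subr0; apply/asboolP.
have := continuous_cvg _ (@sqrt_continuous R _) (@L_cvg u u).
rewrite L0 sqrtr0 => H; exact: H.
Qed.

Lemma cst_cauchy (x : V) : (fun=> x) \in cauchy_sequences.
Proof.
by apply/asboolP => e e0; exists 0%N => m n _ _; rewrite subrr seminorm0.
Qed.

Definition to_completion (x : V) : completion :=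
  \pi_completion (CauchySeq (cst_cauchy x)).

Lemma to_completion_linear : linear to_completion.
Proof.
move=> a x y; rewrite /to_completion -piZ -pi_add; congr (\pi_completion _).
exact: val_inj.
Qed.

HB.instance Definition _ := GRing.isLinear.Build R[i] V completion _
  to_completion to_completion_linear.

Lemma to_completionE x y :
  completion_form (to_completion x) (to_completion y) = Q x y.
Proof.
rewrite completion_form_pi /form /L.
rewrite (_ : rseq _ _ = cst (r x y)) // (_ : rseq _ _ = cst (r x ('i *: y))) //.
by rewrite !lim_cst // -rip_Im /r; case: (Q x y).
Qed.

Lemma to_completion_approx u x e : 0 <= e ->
  (exists N, forall n, (N <= n)%N -> seminorm (u n - x) <= e) ->
  complex.Re (completion_form (\pi_completion u - to_completion x)
                              (\pi_completion u - to_completion x)) <= e ^+ 2.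
Proof.
move=> e0 [N HN]; pose w := u - CauchySeq (cst_cauchy x).
have -> : \pi_completion u - to_completion x = \pi_completion w.
  by rewrite /to_completion -scaleN1r -piZ -pi_add scaleN1r.
rewrite completion_form_pi /form /=; apply: limr_le; first exact: rseq_cvg.
exists N => // n /= Nn; rewrite /rseq -seminorm_sqr ler_sqr ?nnegrE ?seminorm_ge0 //.
exact: HN.
Qed.

End semi_inner_product.

Section completion_norm.
Context {R : realType} {V : lmodType R[i]} (Q : @semi_inner_product R V).

Definition completion_sip : @semi_inner_product R (completion Q) :=
  SemiInnerProduct (@completion_form_ge0 _ _ Q).

Lemma completion_form_gt0 (x : completion Q) : x != 0 -> 0 < completion_form x x.
Proof.
move=> x0; rewrite lt_neqAle completion_form_ge0 andbT eq_sym.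
by apply: contra_neq x0 => /completion_form_eq0.
Qed.

HB.instance Definition _ := isDotProduct.Build R[i] (completion Q)
  (@completion_form _ _ Q) completion_form_gt0.

Definition completion_norm (x : completion Q) : R[i] :=
  (seminorm completion_sip x)%:C.

Lemma completion_normD x y :
  completion_norm (x + y) <= completion_norm x + completion_norm y.
Proof. by rewrite -rmorphD lecR seminormD. Qed.

Lemma completion_normZ (a : R[i]) x :
  completion_norm (a *: x) = `|a| * completion_norm x.
Proof. by rewrite rnormE -rmorphM /completion_norm seminormZ. Qed.

Lemma completion_norm0 x : completion_norm x = 0 -> x = 0.
Proof.
move=> /complexI /eqP; rewrite sqrtr_eq0 => x0; apply: completion_form_eq0.
have {x0} : complex.Re (completion_form x x) <= 0 by [].
have := completion_form_ge0 x; case: (completion_form x x) => a b.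
rewrite lecE /= => /andP[/eqP -> a0] a0'.
by have -> : a = 0 by apply/le_anti/andP.
Qed.

HB.instance Definition _ := Lmodule_isNormed.Build R[i] (completion Q)
  completion_normD completion_normZ completion_norm0.

Lemma completion_normE (x : completion Q) : `|x| ^+ 2 = completion_form x x.
Proof.
transitivity ((seminorm completion_sip x ^+ 2)%:C); first by rewrite rmorphXn.
rewrite seminorm_sqr -/(sip_form completion_sip) RRe_real //.
by rewrite ger0_real // completion_form_ge0.
Qed.

Lemma norm_to_completion x : `|to_completion Q x| = (seminorm Q x)%:C.
Proof.
congr (Num.sqrt (complex.Re _))%:C; exact: to_completionE.
Qed.

Lemma rnorm_completion (x : completion Q) : rnorm x = seminorm completion_sip x.
Proof. by []. Qed.

Lemma to_completion_approx_norm (u : cauchy_seq Q) x e : 0 <= e ->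
  (exists N, forall n, (N <= n)%N -> seminorm Q (u n - x) <= e) ->
  rnorm (\pi_(completion Q) u - to_completion Q x) <= e.
Proof.
move=> e0 ux; rewrite rnorm_completion -ler_sqr ?nnegrE ?seminorm_ge0 //.
by rewrite seminorm_sqr; exact: to_completion_approx.
Qed.

Lemma to_completion_dense_norm (x : completion Q) (e : R) : 0 < e ->
  exists v, rnorm (x - to_completion Q v) <= e.
Proof.
move=> e0; have [u ->] := completion_surj x.
have /asboolP /(_ e e0)[N HN] := valP u.
exists (u N); apply: to_completion_approx_norm (ltW e0) _.
by exists N => n Nn; exact/ltW/HN.
Qed.

Lemma to_completion_dense : dense (range (to_completion Q)).
Proof.
move=> O [x Ox] oO; have : nbhs x O by exact: open_nbhs_nbhs.
rewrite -nbhs_ballE => -[e /= e0 He].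
have re0 : 0 < complex.Re e by move: e0; rewrite ltcE => /andP[].
have [v Hv] := to_completion_dense_norm x (divr_gt0 re0 (ltr0n _ 2)).
exists (to_completion Q v); split; last by exists v.
apply: He; rewrite -ball_normE /ball_ /=.
rewrite rnormE ltcE /=; move: e0; rewrite ltcE => /andP[-> _] /=.
by apply: le_lt_trans Hv _; rewrite gtr_pMr // invf_lt1 // ltr1n.
Qed.

Lemma completion_complete (F : set_system (completion Q)) :
  ProperFilter F -> cauchy F -> cvg F.
Proof.
move=> FF /cauchyP Fc.
pose d n : R := n.+1%:R^-1.
have d0 n : 0 < d n by rewrite invr_gt0 ltr0n.
have dle n m : (n <= m)%N -> d m <= d n.
  by move=> nm; rewrite lef_pV2 ?posrE ?ltr0n // ler_nat.
have small e : 0 < e -> exists N, d N < e.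
  move=> e0; have /(@cvgrPdist_lt _ R^o) := cvg_harmonic (R := R).
  move=> /(_ e e0) [N _ /(_ N (leqnn N))] /=.
  by rewrite sub0r normrN gtr0_norm //; exists N.
have /choice[x Fx] n : exists x, F (ball x (d n)%:C) by apply: Fc; rewrite ltcR.
have /choice[v xv] n : exists v, rnorm (x n - to_completion Q v) <= d n.
  exact: to_completion_dense_norm.
have tri (a b c : completion Q) : rnorm (a - c) <= rnorm (a - b) + rnorm (b - c).
  by rewrite !rnorm_completion -[a - c](subrKA b) seminormD.
have sym (a b : completion Q) : rnorm (a - b) = rnorm (b - a).
  by rewrite !rnorm_completion seminormB.
have Fxn n : F [set y | rnorm (x n - y) < d n].
  apply: filterS (Fx n) => y; rewrite -ball_normE /ball_ /= rnormE ltcR //.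
have vv n m : seminorm Q (v n - v m) <= 2 * d n + 2 * d m.
  have [y [/= yn ym]] := filter_ex (filterI (Fxn n) (Fxn m)).
  have -> : seminorm Q (v n - v m) =
      rnorm (to_completion Q (v n) - to_completion Q (v m)).
    by rewrite -linearB /rnorm norm_to_completion.
  have := tri (to_completion Q (v n)) (x n) (to_completion Q (v m)).
  have := tri (x n) y (to_completion Q (v m)).
  have := tri y (x m) (to_completion Q (v m)).
  have := xv n; have := xv m; rewrite (sym y (x m)) (sym (to_completion Q (v n)) (x n)).
  by move: yn ym; lra.
have vc : v \in cauchy_sequences Q.
  apply/asboolP => e e0; have [|N HN] := small (e / 4); first by rewrite divr_gt0.
  exists N => m n /dle ? /dle ?; apply: le_lt_trans (vv _ _) _; lra.
pose l := \pi_(completion Q) (CauchySeq vc).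
apply: (@cvgP _ _ l); apply/cvgrPdist_lt => e e0.
have re0 : 0 < complex.Re e by move: e0; rewrite ltcE => /andP[].
have [|N HN] := small (complex.Re e / 6); first by rewrite divr_gt0.
apply: filterS (Fxn N) => y yN; rewrite rnormE ltcE /=.
move: e0; rewrite ltcE => /andP[-> _] /=.
have lv : rnorm (l - to_completion Q (v N)) <= 4 * d N.
  apply: to_completion_approx_norm; first by rewrite mulr_ge0 // ltW.
  exists N => n /dle ? /=; apply: le_trans (vv _ _) _; lra.
have := tri l (to_completion Q (v N)) y.
have := tri (to_completion Q (v N)) (x N) y.
have := xv N; rewrite (sym (to_completion Q (v N)) (x N)) => ? ? ?.
move: yN lv => /=; lra.
Qed.

HB.instance Definition _ :=
  Uniform_isComplete.Build (completion Q) completion_complete.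

HB.instance Definition _ := CompleteNormedModule.on (completion Q).

End completion_norm.

Record two_category_data (R : realType) := TwoCategoryData {
  obj : Type;
  (* [arr A B] is the type of the 1-arrows [B <- A]. *)
  arr : obj -> obj -> Type;
  unit1 : forall A, arr A A;
  comp1 : forall A B C, arr B C -> arr A B -> arr A C;
  comp1A : forall A B C D (r : arr C D) (s : arr B C) (t : arr A B),
    comp1 r (comp1 s t) = comp1 (comp1 r s) t;
  comp1_unitl : forall A B (r : arr A B), comp1 (unit1 B) r = r;
  comp1_unitr : forall A B (r : arr A B), comp1 r (unit1 A) = r;
  hom2 : forall A B, arr A B -> arr A B -> completeNormedModType R[i];
  unit2 : forall A B (r : arr A B), hom2 r r;
  vcomp : forall A B (r s t : arr A B), hom2 s t -> hom2 r s -> hom2 r t;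
  hcomp : forall A B C (r r' : arr B C) (s s' : arr A B),
    hom2 r r' -> hom2 s s' -> hom2 (comp1 r s) (comp1 r' s');
  star : forall A B (r s : arr A B), hom2 r s -> hom2 s r }.

Arguments arr {R t} A B : rename.
Arguments unit1 {R t} A : rename.
Arguments comp1 {R t A B C} r s : rename.
Arguments comp1A {R t A B C D} r s u : rename.
Arguments comp1_unitl {R t A B} r : rename.
Arguments comp1_unitr {R t A B} r : rename.
Arguments hom2 {R t A B} r s : rename.
Arguments unit2 {R t A B} r : rename.
Arguments vcomp {R t A B r s u} S T : rename.
Arguments hcomp {R t A B C r r' s s'} S T : rename.
Arguments star {R t A B r s} S : rename.

(* Composition of 1-arrows is strict, but the associativity and unit laws are
   not conversions: 2-arrows are transported along them. *)
Definition hom2_cast {R : realType} {K : two_category_data R} {A B : obj K}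
    {r r' s s' : arr A B} (er : r = r') (es : s = s') (S : hom2 r s) : hom2 r' s' :=
  ecast z (hom2 z s') er (ecast z (hom2 r z) es S).

Declare Scope two_category_scope.
Delimit Scope two_category_scope with tc.
Local Open Scope two_category_scope.

Notation "r ⊙ s" := (comp1 r s)
  (at level 40, left associativity) : two_category_scope.
Notation "S ∘ T" := (vcomp S T)
  (at level 45, left associativity) : two_category_scope.
Notation "S ⊗ T" := (hcomp S T)
  (at level 40, left associativity) : two_category_scope.
Notation "S ^†" := (star S)
  (at level 1, left associativity, format "S ^†") : two_category_scope.

Section two_cstar_category.
Context {R : realType}.

Section positive.
Context {K : two_category_data R} {A B : obj K} {r : arr A B}.
Implicit Type S : hom2 r r.

Definition invertible2 S := exists T, S ∘ T = unit2 r /\ T ∘ S = unit2 r.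

Definition spectrum2 S : set R[i] :=
  [set l | ~ invertible2 (S - l *: unit2 r)].

(* [0 <= l] in [R[i]] forces [l] to be real. *)
Definition positive2 S := S^† = S /\ spectrum2 S `<=` [set l | 0 <= l].

End positive.

Record is_two_cstar_category (K : two_category_data R) : Prop := {
  vcompA : forall (A B : obj K) (r s t u : arr A B)
    (S : hom2 t u) (T : hom2 s t) (U : hom2 r s), S ∘ (T ∘ U) = (S ∘ T) ∘ U;
  vcomp_unitl : forall (A B : obj K) (r s : arr A B) (S : hom2 r s),
    unit2 s ∘ S = S;
  vcomp_unitr : forall (A B : obj K) (r s : arr A B) (S : hom2 r s),
    S ∘ unit2 r = S;
  hcomp_unit : forall (A B C : obj K) (r : arr B C) (s : arr A B),
    unit2 r ⊗ unit2 s = unit2 (r ⊙ s);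
  interchange : forall (A B C : obj K) (r r' r'' : arr B C)
    (s s' s'' : arr A B) (S' : hom2 r' r'') (S : hom2 r r')
    (T' : hom2 s' s'') (T : hom2 s s'),
    (S' ∘ S) ⊗ (T' ∘ T) = (S' ⊗ T') ∘ (S ⊗ T);
  hcompA : forall (A B C D : obj K) (r r' : arr C D) (s s' : arr B C)
    (t t' : arr A B) (S : hom2 r r') (T : hom2 s s') (U : hom2 t t'),
    hom2_cast (comp1A r s t) (comp1A r' s' t') (S ⊗ (T ⊗ U)) = (S ⊗ T) ⊗ U;
  hcomp_unitl : forall (A B : obj K) (r s : arr A B) (S : hom2 r s),
    hom2_cast (comp1_unitl r) (comp1_unitl s) (unit2 (unit1 B) ⊗ S) = S;
  hcomp_unitr : forall (A B : obj K) (r s : arr A B) (S : hom2 r s),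
    hom2_cast (comp1_unitr r) (comp1_unitr s) (S ⊗ unit2 (unit1 A)) = S;
  vcomp_linearl : forall (A B : obj K) (r s t : arr A B) (T : hom2 r s),
    linear (fun S : hom2 s t => S ∘ T);
  vcomp_linearr : forall (A B : obj K) (r s t : arr A B) (S : hom2 s t),
    linear (fun T : hom2 r s => S ∘ T);
  hcomp_linearl : forall (A B C : obj K) (r r' : arr B C) (s s' : arr A B)
    (T : hom2 s s'), linear (fun S : hom2 r r' => S ⊗ T);
  hcomp_linearr : forall (A B C : obj K) (r r' : arr B C) (s s' : arr A B)
    (S : hom2 r r'), linear (fun T : hom2 s s' => S ⊗ T);
  star_antilinear : forall (A B : obj K) (r s : arr A B) (a : R[i])
    (S T : hom2 r s), (a *: S + T)^† = conjc a *: S^† + T^†;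
  starK : forall (A B : obj K) (r s : arr A B) (S : hom2 r s), S^†^† = S;
  star_vcomp : forall (A B : obj K) (r s t : arr A B)
    (S : hom2 s t) (T : hom2 r s), (S ∘ T)^† = T^† ∘ S^†;
  star_hcomp : forall (A B C : obj K) (r r' : arr B C) (s s' : arr A B)
    (S : hom2 r r') (T : hom2 s s'), (S ⊗ T)^† = S^† ⊗ T^†;
  norm_vcomp : forall (A B : obj K) (r s t : arr A B)
    (T : hom2 s t) (S : hom2 r s), `|T ∘ S| <= `|T| * `|S|;
  norm_star_vcomp : forall (A B : obj K) (r s : arr A B) (S : hom2 r s),
    `|S^† ∘ S| = `|S| ^+ 2;
  star_vcomp_positive : forall (A B : obj K) (r s : arr A B) (S : hom2 r s),
    positive2 (S^† ∘ S) }.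

Record two_cstar_category := TwoCstarCategory {
  two_cat :> two_category_data R;
  two_catP : is_two_cstar_category two_cat }.

Definition closed_under_projections (K : two_category_data R) : Prop :=
  forall (A B : obj K) (r : arr A B) (P : hom2 r r), P ∘ P = P -> P^† = P ->
  exists (rP : arr A B) (W : hom2 rP r), W^† ∘ W = unit2 rP /\ W ∘ W^† = P.

Definition closed_under_direct_sums (K : two_category_data R) : Prop :=
  forall (A B : obj K) (r1 r2 : arr A B),
  exists (r : arr A B) (W1 : hom2 r1 r) (W2 : hom2 r2 r),
    [/\ W1^† ∘ W1 = unit2 r1, W2^† ∘ W2 = unit2 r2,
        W1^† ∘ W2 = 0, W2^† ∘ W1 = 0 &
        W1 ∘ W1^† + W2 ∘ W2^† = unit2 r].

Definition conjugation_equations {K : two_category_data R} {A B : obj K}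
    {r : arr A B} {rb : arr B A} (Rr : hom2 (unit1 A) (rb ⊙ r))
    (Rrb : hom2 (unit1 B) (r ⊙ rb)) : Prop :=
  hom2_cast (erefl _) (comp1_unitl r) (Rrb^† ⊗ unit2 r)
    ∘ hom2_cast (comp1_unitr r) (comp1A r rb r) (unit2 r ⊗ Rr) = unit2 r /\
  hom2_cast (erefl _) (comp1_unitl rb) (Rr^† ⊗ unit2 rb)
    ∘ hom2_cast (comp1_unitr rb) (comp1A rb r rb) (unit2 rb ⊗ Rrb) = unit2 rb.

Definition closed_under_conjugation (K : two_category_data R) : Prop :=
  forall (A B : obj K) (r : arr A B),
  exists (rb : arr B A) (Rr : hom2 (unit1 A) (rb ⊙ r))
    (Rrb : hom2 (unit1 B) (r ⊙ rb)), conjugation_equations Rr Rrb.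

(* An isometric *-isomorphism of End(iota_A) onto C(Omega). By Gelfand duality a
   compact Hausdorff space Omega with such an isomorphism exists and is unique up
   to homeomorphism. The type [R[i]^o] is [R[i]] with its usual topology. *)
Record gelfand_identification (K : two_category_data R) (A : obj K)
    (Omega : topologicalType) := GelfandIdentification {
  gelfand :> hom2 (unit1 A) (unit1 A) -> Omega -> R[i];
  gelfand_bij : set_bij [set: hom2 (unit1 A) (unit1 A)]
    [set f | continuous (f : Omega -> R[i]^o)] gelfand;
  gelfand_linear : forall a S T w,
    gelfand (a *: S + T) w = a * gelfand S w + gelfand T w;
  gelfand_vcomp : forall S T w, gelfand (S ∘ T) w = gelfand S w * gelfand T w;
  gelfand_unit : forall w, gelfand (unit2 (unit1 A)) w = 1;
  gelfand_star : forall S w, gelfand S^† w = conjc (gelfand S w);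
  gelfand_norm : forall S, rnorm S = sup [set rnorm (gelfand S w) | w in setT] }.

End two_cstar_category.

Arguments two_cstar_category : clear implicits.
Arguments gelfand_identification {R K} A Omega.

Section gns.
Context {R : realType} {K : two_cstar_category R} {A B : obj K}.
Context {r : arr A B} {rb : arr B A} (Rr : hom2 (unit1 A) (rb ⊙ r)).

Definition end_inner (T S : hom2 r r) : hom2 (unit1 A) (unit1 A) :=
  Rr^† ∘ (unit2 rb ⊗ (S^† ∘ T)) ∘ Rr.

Context {Omega : topologicalType} (g : gelfand_identification A Omega).
Variable w : Omega.

Definition end_inner_at (T S : hom2 r r) : R[i] := g (end_inner T S) w.

Let KP := two_catP K.

Lemma star_unit (C D : obj K) (s : arr C D) : (unit2 s)^† = unit2 s.
Proof.
rewrite -[LHS](vcomp_unitr KP) -{2}(starK KP (unit2 s)) -(star_vcomp KP).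
by rewrite (vcomp_unitr KP) (starK KP).
Qed.

Lemma gelfand_positive S : positive2 S -> 0 <= g S w.
Proof.
move=> [_]; apply => -[T [ST _]].
have := gelfand_vcomp g (S - g S w *: unit2 (unit1 A)) T w.
rewrite ST gelfand_unit.
have -> : g (S - g S w *: unit2 (unit1 A)) w = 0.
  rewrite addrC -scaleNr gelfand_linear.
  by rewrite gelfand_unit mulr1 addNr.
by rewrite mul0r => /eqP; rewrite oner_eq0.
Qed.

Lemma end_inner_at_ge0 T : 0 <= end_inner_at T T.
Proof.
pose X := (unit2 rb ⊗ T) ∘ Rr.
have -> : end_inner_at T T = g (X^† ∘ X) w.
  congr (g _ w); rewrite /X (star_vcomp KP) (star_hcomp KP) star_unit.
  rewrite (vcompA KP) -(vcompA KP Rr^†) -(interchange KP).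
  by rewrite (vcomp_unitl KP).
exact/gelfand_positive/star_vcomp_positive.
Qed.

Lemma end_inner_atC T S :
  end_inner_at T S = (-1) ^+ false * conjc (end_inner_at S T).
Proof.
rewrite expr0 mul1r /end_inner_at. rewrite -gelfand_star; congr (g _ w).
rewrite /end_inner !(star_vcomp KP) (star_hcomp KP) star_unit.
by rewrite (star_vcomp KP) !(starK KP) (vcompA KP).
Qed.

Lemma end_inner_at_linearl S : linear_for *%R (end_inner_at^~ S).
Proof.
move=> a T U; rewrite /end_inner_at /end_inner.
by rewrite (vcomp_linearr KP) (hcomp_linearr KP) (vcomp_linearr KP)
  (vcomp_linearl KP) gelfand_linear.
Qed.

Lemma end_inner_at_linearr T : linear_for (@conjc R \; *%R) (end_inner_at T).
Proof.
move=> a S U; rewrite end_inner_atC end_inner_at_linearl expr0 mul1r.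
rewrite rmorphD rmorphM /= [end_inner_at T S]end_inner_atC.
by rewrite [end_inner_at T U]end_inner_atC expr0 !mul1r.
Qed.

HB.instance Definition _ := bilinear_isBilinear.Build R[i] (hom2 r r) (hom2 r r)
  R[i] *%R (@conjc R \; *%R) end_inner_at
  (end_inner_at_linearl, end_inner_at_linearr).
HB.instance Definition _ := isHermitianSesquilinear.Build R[i] (hom2 r r)
  false (@conjc R) end_inner_at end_inner_atC.

Definition end_sip : @semi_inner_product R (hom2 r r) :=
  SemiInnerProduct end_inner_at_ge0.

Definition end_hilbert := completion end_sip.

(* The bounded operator extending left multiplication by [T]; it is unique since
   the image of [to_completion] is dense. *)
Definition gns (T : hom2 r r) : end_hilbert -> end_hilbert :=
  xget (fun=> 0) [set f | [/\ linear f, continuous f &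
    forall S, f (to_completion end_sip S) = to_completion end_sip (T ∘ S)]].

End gns.

Arguments end_hilbert {R K A B r rb} Rr {Omega} g w.
Arguments gns {R K A B r rb} Rr {Omega} g w T _.

(* The adjoint is unique when it exists, as [completion_form] is definite; the
   adjoint of [gns Rr g w T] is [gns Rr g w T^†]. *)
Definition adjoint {R : realType} {V : lmodType R[i]}
    {Q : @semi_inner_product R V} (f : completion Q -> completion Q) :
    completion Q -> completion Q :=
  xget (fun=> 0) [set h | forall x y : completion Q,
    completion_form (f x) y = completion_form x (h y)].

Definition opnorm {R : realType} {V W : normedModType R[i]} (f : V -> W) : R :=
  sup [set rnorm (f x) | x in [set x | rnorm x <= 1]].

Section bundles.
Context {R : realType}.

(* Fibres are given as subsets of ambient vector spaces (for the operator
   algebras below, the space of all maps of a Hilbert space to itself), the norm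
   and the operations being relevant on these subsets only. The zero algebra is
   a C*-algebra. *)
Record is_banach_space (V : lmodType R[i]) (E : set V) (nrm : V -> R) : Prop := {
  banach_0 : E 0;
  banach_linear : forall a x y, E x -> E y -> E (a *: x + y);
  banach_norm_ge0 : forall x, E x -> 0 <= nrm x;
  banach_norm_eq0 : forall x, E x -> nrm x = 0 -> x = 0;
  banach_normZ : forall a x, E x -> nrm (a *: x) = rnorm a * nrm x;
  banach_normD : forall x y, E x -> E y -> nrm (x + y) <= nrm x + nrm y;
  banach_complete : forall u : nat -> V, (forall n, E (u n)) ->
    (forall e : R, 0 < e -> exists N, forall m n,
      (N <= m)%N -> (N <= n)%N -> nrm (u m - u n) < e) ->
    exists2 l, E l & (fun n => nrm (u n - l)) @ \oo --> (0 : R) }.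

Record is_cstar_algebra (V : lmodType R[i]) (E : set V) (nrm : V -> R)
    (mul : V -> V -> V) (invol : V -> V) : Prop := {
  cstar_banach : is_banach_space E nrm;
  cstar_mul : forall x y, E x -> E y -> E (mul x y);
  cstar_mulA : forall x y z, E x -> E y -> E z ->
    mul x (mul y z) = mul (mul x y) z;
  cstar_linearl : forall a x y z, E x -> E y -> E z ->
    mul (a *: x + y) z = a *: mul x z + mul y z;
  cstar_linearr : forall a x y z, E x -> E y -> E z ->
    mul x (a *: y + z) = a *: mul x y + mul x z;
  cstar_invol : forall x, E x -> E (invol x);
  cstar_involK : forall x, E x -> invol (invol x) = x;
  cstar_invol_antilinear : forall a x y, E x -> E y ->
    invol (a *: x + y) = conjc a *: invol x + invol y;
  cstar_involM : forall x y, E x -> E y -> invol (mul x y) = mul (invol y) (invol x);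
  cstar_normM : forall x y, E x -> E y -> nrm (mul x y) <= nrm x * nrm y;
  cstar_norm_invol : forall x, E x -> nrm (mul (invol x) x) = nrm x ^+ 2 }.

Context {Omega : topologicalType}.
Variables (V : Omega -> lmodType R[i]) (E : forall w, set (V w)).
Variables (nrm : forall w, V w -> R).
Variable Gamma : set (forall w, V w).

Record is_banach_bundle : Prop := {
  bundle_compact : compact [set: Omega];
  bundle_hausdorff : hausdorff_space Omega;
  bundle_fiber : forall w, is_banach_space (@E w) (@nrm w);
  bundle_section : forall X, Gamma X -> forall w, E (X w);
  bundle_0 : Gamma (fun=> 0);
  bundle_linear : forall a X Y, Gamma X -> Gamma Y ->
    Gamma (fun w => a *: X w + Y w);
  bundle_dense : forall w (x : V w) (e : R), E x -> 0 < e ->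
    exists2 X, Gamma X & nrm (x - X w) < e;
  bundle_norm : forall X, Gamma X -> continuous (fun w => nrm (X w));
  bundle_local : forall X : (forall w, V w), (forall w, E (X w)) ->
    (forall (w : Omega) (e : R), 0 < e -> exists2 Y, Gamma Y &
      \forall w' \near w, nrm (X w' - Y w') < e) ->
    Gamma X }.

Variables (mul : forall w, V w -> V w -> V w) (invol : forall w, V w -> V w).

Record is_cstar_bundle : Prop := {
  cstar_bundle_banach : is_banach_bundle;
  cstar_bundle_fiber : forall w,
    is_cstar_algebra (@E w) (@nrm w) (@mul w) (@invol w);
  cstar_bundle_mul : forall X Y, Gamma X -> Gamma Y ->
    Gamma (fun w => mul (X w) (Y w));
  cstar_bundle_invol : forall X, Gamma X -> Gamma (fun w => invol (X w)) }.

End bundles.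

Arguments is_banach_bundle {R Omega} V E nrm Gamma.
Arguments is_cstar_bundle {R Omega} V E nrm Gamma mul invol.

(* Main.v *)
(* Write Y_T = (1 ⊗ T) ∘ R, an element of H = Hom(iota_A, rb ⊙ r), so that
   <T, S> = Y_S^* ∘ Y_T. By Frobenius reciprocity T |-> Y_T is a bijection of
   End(r) onto H, and H is a Banach module over End(iota_A) = C(Omega) with
   ||Y||^2 = sup_w <Y, Y>(w); hence End(r) is complete for the norm
   sup_w |T|_w, where |T|_w is the seminorm of the fibre at w. The conjugation
   equations give Y_{TS} = E ∘ (Y_S ⊗ Y_T) for a fixed 2-arrow E, so that
   |TS|_w <= M |T|_w |S|_w with M independent of w, and therefore
   |T|_w / m <= ||pi_w(T)|| <= M |T|_w. Multiplying by functions such as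
   e / max(e, |T|_w) lifts elements of a fibre without increasing their norm, so
   End(r) maps onto every fibre, already complete, and pi_w(End(r)) is closed.
   Continuity of ||pi_w(T)|| follows from that of |P|_w for P = (T^* T)^(2^k),
   as ||pi_w(P)|| is a power of ||pi_w(T)|| and the constants m, M disappear when
   k tends to infinity. *)
Require Import Defs.
From mathcomp Require Import all_boot all_order all_algebra.
From mathcomp Require Import all_classical all_reals all_analysis.
From mathcomp Require Import complex.
From mathcomp Require Import ring lra.
Set Implicit Arguments.
Unset Strict Implicit.
Unset Printing Implicit Defensive.
Import numFieldNormedType.Exports.
Import Order.TTheory GRing.Theory Num.Theory.
Local Open Scope classical_set_scope.
Local Open Scope ring_scope.
Local Open Scope two_category_scope.

(** * Norms with real values *)

Section real_norm.
Context {R : realType} {V : normedModType R[i]}.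
Implicit Types (x y z : V) (a : R[i]).

Lemma rnorm_ge0 x : 0 <= rnorm x.
Proof. by have := normr_ge0 x; rewrite rnormE ler0c. Qed.

Lemma rnormD x y : rnorm (x + y) <= rnorm x + rnorm y.
Proof. by rewrite -lecR rmorphD /= -!rnormE ler_normD. Qed.

Lemma rnormZ a x : rnorm (a *: x) = rnorm a * rnorm x.
Proof. by apply: complexI; rewrite rmorphM /= -!rnormE normrZ. Qed.

Lemma rnorm0 : rnorm (0 : V) = 0.
Proof. by rewrite /rnorm normr0. Qed.

Lemma rnormN x : rnorm (- x) = rnorm x.
Proof. by rewrite /rnorm normrN. Qed.

Lemma rnormB x y : rnorm (x - y) = rnorm (y - x).
Proof. by rewrite -rnormN opprB. Qed.

Lemma rnorm_eq0 x : rnorm x = 0 -> x = 0.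
Proof. by move=> x0; apply/normr0_eq0; rewrite rnormE x0. Qed.

Lemma rnorm_tri y x z : rnorm (x - z) <= rnorm (x - y) + rnorm (y - z).
Proof. by rewrite -{1}(subrKA y) rnormD. Qed.

Lemma rnorm_leB x y : rnorm x <= rnorm (x - y) + rnorm y.
Proof. by rewrite -{1}(subrK y x) rnormD. Qed.

End real_norm.

Section real_norm_complex.
Context {R : realType}.

Lemma rnormM (a b : R[i]) : rnorm (a * b) = rnorm a * rnorm b.
Proof. by apply: complexI; rewrite rmorphM /= -!rnormE normrM. Qed.

Lemma rnorm_real (a : R) : rnorm (a%:C)%C = `|a|.
Proof. by rewrite rnormCE /= expr0n addr0 sqrtr_sqr. Qed.

Lemma rnorm_nat n : rnorm (n%:R : R[i]) = n%:R.
Proof. by rewrite -(rmorph_nat (real_complex R)) rnorm_real ger0_norm. Qed.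

Lemma rnorm_Re (a : R[i]) : `|complex.Re a| <= rnorm a.
Proof. by rewrite rnormCE -sqrtr_sqr ler_sqrt ?lerDl ?sqr_ge0 ?addr_ge0 ?sqr_ge0. Qed.

End real_norm_complex.

(** * Geometric estimates and completeness *)

Section limits.
Context {R : realType}.

Lemma expr_half_small (C e : R) : 0 < e -> exists N, C * 2^-1 ^+ N < e.
Proof.
move=> e0; have [C0|C0] := leP C 0.
  by exists 0%N; apply: le_lt_trans e0; rewrite expr0 mulr1.
have [N HN] : exists N, C / e < N%:R.
  by exists (Num.bound (C / e)); apply: archi_boundP; rewrite divr_ge0 // ltW.
exists N; rewrite exprVn ltr_pdivrMr ?exprn_gt0 // mulrC -ltr_pdivrMr //.
by apply: lt_trans HN _; rewrite -natrX ltr_nat ltn_expl.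
Qed.

Lemma le_half_expr (x C : R) : (forall n, x <= C * 2^-1 ^+ n) -> x <= 0.
Proof.
move=> H; rewrite leNgt; apply/negP => /(expr_half_small C)[N].
by rewrite ltNge H.
Qed.

Context {V : completeNormedModType R[i]}.

Lemma complete_of_rnorm_cauchy (u : nat -> V) :
  (forall e : R, 0 < e -> exists N, forall m n, (N <= m)%N -> (N <= n)%N ->
    rnorm (u m - u n) < e) ->
  exists l, forall e : R, 0 < e -> exists N, forall n, (N <= n)%N ->
    rnorm (u n - l) < e.
Proof.
move=> uc.
have cu : cvg (u @ \oo).
  apply/cauchy_cvgP/cauchy_exP => e e0.
  (* A positive element of [R[i]] is real, so its real part carries the whole estimate. *)
  have re0 : 0 < complex.Re e by move: e0; rewrite ltcE => /andP[].
  have [N HN] := uc _ re0; exists (u N); exists N => // n /= Nn.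
  rewrite -ball_normE /ball_ /= rnormE ltcE /= HN // andbT.
  by move: e0; rewrite ltcE => /andP[].
exists (lim (u @ \oo)) => e e0.
have /cvgrPdist_lt/(_ e%:C%C) [|N _ HN] := cu; first by rewrite ltcR.
by exists N => n Nn; have := HN n Nn; rewrite /= rnormE ltcR rnormB.
Qed.

Lemma geometric_cvg (u : nat -> V) (C : R) :
  (forall n, rnorm (u n.+1 - u n) <= C * 2^-1 ^+ n) ->
  exists l, forall n, rnorm (u n - l) <= 2 * C * 2^-1 ^+ n.
Proof.
move=> H.
have C0 : 0 <= C by have := H 0%N; rewrite expr0 mulr1; apply: le_trans (rnorm_ge0 _).
have step n k : rnorm (u (n + k)%N - u n) <= 2 * C * 2^-1 ^+ n.
  (* Subtracting the remaining tail [2 * C * 2^-1 ^+ (n + k)] is what makes the induction on [k]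
     close. *)
  suff : rnorm (u (n + k)%N - u n) <= 2 * C * 2^-1 ^+ n - 2 * C * 2^-1 ^+ (n + k).
    by move/le_trans; apply; rewrite lerBlDr lerDl !mulr_ge0 ?exprn_ge0 ?invr_ge0.
  elim: k => [|k IH]; first by rewrite addn0 !subrr rnorm0.
  apply: le_trans (rnorm_tri (u (n + k)%N) _ _) _; rewrite addnS.
  have := H (n + k)%N; rewrite (exprS _ (n + k)); move: IH; lra.
have [e e0|l Hl] := @complete_of_rnorm_cauchy u.
  have [N HN] := expr_half_small (4 * C) e0; exists N => m n.
  move=> /subnKC <- /subnKC <-; apply: le_lt_trans HN.
  apply: le_trans (rnorm_tri (u N) _ _) _; rewrite (rnormB (u N)).
  by have := step N (m - N)%N; have := step N (n - N)%N; lra.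
exists l => n; apply/ler_addgt0Pr => e e0; have [N HN] := Hl e e0.
apply: le_trans (rnorm_tri (u (n + N)%N) _ _) _.
by rewrite rnormB lerD ?step // ltW // HN // leq_addl.
Qed.

End limits.

(** * Bilinearity, involution and square roots of 2-arrows *)

Section cstar_calculus.
Context {R : realType} {K : two_cstar_category R}.
Let KP := two_catP K.

Section linearity.
Context {A B : obj K} {r s t : arr A B}.
Implicit Types (S : hom2 s t) (T : hom2 r s) (a : R[i]).

Lemma vcompZl a S T : (a *: S) ∘ T = a *: (S ∘ T).
Proof.
have := vcomp_linearl KP T a S 0; rewrite !addr0 => ->.
have := vcomp_linearl KP T 1 0 (0 : hom2 s t).
by rewrite !scale1r addr0 -{1}[_ ∘ T]addr0 => /addrI <-; rewrite addr0.
Qed.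

Lemma vcompDl S S' T : (S + S') ∘ T = S ∘ T + S' ∘ T.
Proof. by have := vcomp_linearl KP T 1 S S'; rewrite !scale1r. Qed.

Lemma vcompBl S S' T : (S - S') ∘ T = S ∘ T - S' ∘ T.
Proof. by rewrite vcompDl -scaleN1r vcompZl scaleN1r. Qed.

Lemma vcompDr S T T' : S ∘ (T + T') = S ∘ T + S ∘ T'.
Proof. by have := vcomp_linearr KP S 1 T T'; rewrite !scale1r. Qed.

Lemma vcompZr a S T : S ∘ (a *: T) = a *: (S ∘ T).
Proof.
have H0 : S ∘ (0 : hom2 r s) = 0.
  by apply: (addrI (S ∘ (0 : hom2 r s))); rewrite -vcompDr !addr0.
by have := vcomp_linearr KP S a T 0; rewrite H0 !addr0.
Qed.

Lemma vcompBr S T T' : S ∘ (T - T') = S ∘ T - S ∘ T'.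
Proof. by rewrite vcompDr -scaleN1r vcompZr scaleN1r. Qed.

Lemma starD S S' : (S + S')^† = S^† + S'^†.
Proof. by have := star_antilinear KP 1 S S'; rewrite conjc1 !scale1r. Qed.

Lemma star0 : (0 : hom2 s t)^† = 0.
Proof. by apply: (addrI ((0 : hom2 s t)^†)); rewrite -starD !addr0. Qed.

Lemma starZ a S : (a *: S)^† = conjc a *: S^†.
Proof. by have := star_antilinear KP a S 0; rewrite star0 !addr0. Qed.

Lemma starB S S' : (S - S')^† = S^† - S'^†.
Proof. by apply: (addIr S'^†); rewrite subrK -starD subrK. Qed.

Lemma rnorm_vcomp S T : rnorm (S ∘ T) <= rnorm S * rnorm T.
Proof. by rewrite -lecR rmorphM /= -!rnormE (norm_vcomp KP). Qed.

Lemma rnorm_star_vcomp S : rnorm (S^† ∘ S) = rnorm S ^+ 2.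
Proof. by apply: complexI; rewrite rmorphXn /= -!rnormE (norm_star_vcomp KP). Qed.

End linearity.

(** The $C^*$-identity bounds [rnorm S ^+ 2] by [rnorm S^† * rnorm S]; a nonzero [rnorm S]
    cancels. *)
Lemma rnorm_star_le (A B : obj K) (s t : arr A B) (S : hom2 s t) :
  rnorm S <= rnorm S^†.
Proof.
have [S0|S0] := leP (rnorm S) 0; first exact: le_trans (rnorm_ge0 _).
rewrite -(ler_pM2r S0) -expr2 -rnorm_star_vcomp; exact: rnorm_vcomp.
Qed.

Lemma rnorm_star (A B : obj K) (s t : arr A B) (S : hom2 s t) :
  rnorm S^† = rnorm S.
Proof.
by apply/le_anti; rewrite rnorm_star_le -{2}(starK KP S) rnorm_star_le.
Qed.

Lemma half_rnorm : rnorm (2^-1 : R[i]) = 2^-1.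
Proof.
have -> : (2^-1 : R[i]) = (2^-1)%:C%C by rewrite fmorphV rmorph_nat.
by rewrite rnorm_real ger0_norm.
Qed.

(* The square root is [unit2 s - z] for the fixed point [z] of the contraction
   [z |-> (x + z ^ 2) / 2] of the ball of radius 1/2. *)
Lemma selfadjoint_sqrt (A B : obj K) (s : arr A B) (x : hom2 s s) :
  x^† = x -> rnorm x <= 2^-1 ->
  exists y : hom2 s s, y^† = y /\ y ∘ y = unit2 s - x.
Proof.
move=> xs x1; pose F (z : hom2 s s) := (2^-1 : R[i]) *: (x + z ∘ z).
pose z n := iter n F 0.
have zs n : (z n)^† = z n.
  elim: n => [|n IH] /=; first exact: star0.
  rewrite /F starZ starD xs (star_vcomp KP) -/(z n) IH.
  by congr (_ *: _); rewrite fmorphV rmorph_nat.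
have FB a b : rnorm a <= 2^-1 -> rnorm b <= 2^-1 ->
    rnorm (F a - F b) <= 2^-1 * rnorm (a - b).
  move=> a1 b1; rewrite /F -scalerBr rnormZ half_rnorm ler_wpM2l //.
  (* The difference of squares is split without commuting [a] and [b]; each summand has norm at most
     half of [rnorm (a - b)]. *)
  have -> : x + a ∘ a - (x + b ∘ b) = a ∘ (a - b) + (a - b) ∘ b.
    by rewrite opprD addrACA subrr add0r vcompBr vcompBl subrKA.
  apply: le_trans (rnormD _ _) _; have d0 := rnorm_ge0 (a - b).
  have := rnorm_vcomp a (a - b); have := rnorm_vcomp (a - b) b.
  have := ler_wpM2r d0 a1; have := ler_wpM2l d0 b1; lra.
have z1 n : rnorm (z n) <= 2^-1.
  elim: n => [|n IH] /=; first by rewrite rnorm0.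
  rewrite /F rnormZ half_rnorm -/(z n).
  have := rnormD x (z n ∘ z n); have := rnorm_vcomp (z n) (z n).
  have := ler_pM (rnorm_ge0 _) (rnorm_ge0 _) IH IH; lra.
have step n : rnorm (z n.+1 - z n) <= 1 * 2^-1 ^+ n.
  elim: n => [|n IH].
    by rewrite mul1r expr0 subr0; apply: le_trans (z1 1%N) _; lra.
  rewrite [leLHS](_ : _ = rnorm (F (z n.+1) - F (z n))) //.
  by apply: le_trans (FB _ _ (z1 _) (z1 _)) _; rewrite exprS; move: IH; lra.
have [l Hl] := geometric_cvg step.
have lle n : rnorm (l - z n) <= 2 * 2^-1 ^+ n.
  by rewrite rnormB; have := Hl n; rewrite mulr1.
have l1 : rnorm l <= 2^-1.
  rewrite -subr_le0; apply: (@le_half_expr _ _ 2) => n.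
  by have := rnorm_leB l (z n); have := lle n; have := z1 n; lra.
have ls : l^† = l.
  apply/eqP; rewrite -subr_eq0; apply/eqP/rnorm_eq0/le_anti; rewrite rnorm_ge0 andbT.
  apply: (@le_half_expr _ _ 4) => n.
  have := rnorm_tri (z n) l^† l; rewrite -{1}(zs n) -starB rnorm_star.
  by have := lle n; have := Hl n; lra.
have Fl : F l = l.
  apply/eqP; rewrite -subr_eq0; apply/eqP/rnorm_eq0/le_anti; rewrite rnorm_ge0 andbT.
  apply: (@le_half_expr _ _ 4) => n.
  have := rnorm_tri (z n.+1) (F l) l; rewrite -[z n.+1]/(F (z n)).
  have := FB _ _ l1 (z1 n); have := Hl n.+1; rewrite -[z n.+1]/(F (z n)) exprS.
  have := lle n; have : 0 <= 2^-1 ^+ n :> R by rewrite exprn_ge0 // invr_ge0.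
  lra.
exists (unit2 s - l); rewrite starB star_unit ls; split=> //.
rewrite vcompBl !vcompBr !(vcomp_unitl KP) (vcomp_unitr KP).
(* Doubling the fixed-point equation gives [x = l + l - l ∘ l], so the square of [unit2 s - l] is
   [unit2 s - x]. *)
have /(congr1 (fun u => (2 : R[i]) *: u)) := Fl.
rewrite /F scalerA divff ?scale1r ?pnatr_eq0 // scaler_nat mulr2n.
move=> E; have -> : x = l + l - l ∘ l by rewrite -E addrK.
by rewrite !opprB opprD -addrA; congr (_ + _); rewrite addrCA.
Qed.

End cstar_calculus.

(** * Equality of 2-arrows across the associativity and unit laws *)

Section heterogeneous_equality.
Context {R : realType} {K : two_cstar_category R}.
Let KP := two_catP K.

(* Equality of 2-arrows up to the transports [hom2_cast]. *)
Definition heq {A B : obj K} {r s r' s' : arr A B} (S : hom2 r s)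
    (S' : hom2 r' s') : Prop :=
  exists (er : r = r') (es : s = s'), hom2_cast er es S = S'.

(** Proof irrelevance collapses both transports, so a chain of [heq] steps through casts ends in a
    plain equation. *)
Lemma heq_eq (A B : obj K) (r s : arr A B) (S S' : hom2 r s) : heq S S' -> S = S'.
Proof.
by case=> er [es <-]; rewrite (Prop_irrelevance er erefl) (Prop_irrelevance es erefl).
Qed.

Lemma heq_refl (A B : obj K) (r s : arr A B) (S : hom2 r s) : heq S S.
Proof. by exists erefl, erefl. Qed.

Lemma heq_sym (A B : obj K) (r s r' s' : arr A B) (S : hom2 r s) (S' : hom2 r' s') :
  heq S S' -> heq S' S.
Proof. by case=> er [es <-]; destruct er, es; exact: heq_refl. Qed.

Lemma heq_trans (A B : obj K) (r s r' s' r'' s'' : arr A B) (S' : hom2 r' s')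
  (S : hom2 r s) (S'' : hom2 r'' s'') : heq S S' -> heq S' S'' -> heq S S''.
Proof. by case=> er [es <-]; destruct er, es. Qed.

Lemma heq_cast (A B : obj K) (r s r' s' : arr A B) (er : r = r') (es : s = s')
  (S : hom2 r s) : heq (hom2_cast er es S) S.
Proof. by destruct er, es; exact: heq_refl. Qed.

Lemma heq_star (A B : obj K) (r s r' s' : arr A B) (S : hom2 r s) (S' : hom2 r' s') :
  heq S S' -> heq S^† S'^†.
Proof. by case=> er [es <-]; destruct er, es; exact: heq_refl. Qed.

Lemma heq_hcomp (A B C : obj K) (r s r' s' : arr B C) (t u t' u' : arr A B)
  (S : hom2 r s) (S' : hom2 r' s') (T : hom2 t u) (T' : hom2 t' u') :
  heq S S' -> heq T T' -> heq (S ⊗ T) (S' ⊗ T').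
Proof.
by case=> er [es <-] [et [eu <-]]; destruct er, es, et, eu; exact: heq_refl.
Qed.

Lemma heq_vcomp (A B : obj K) (r s t r' s' t' : arr A B)
  (S : hom2 s t) (S' : hom2 s' t') (T : hom2 r s) (T' : hom2 r' s') :
  heq S S' -> heq T T' -> heq (S ∘ T) (S' ∘ T').
Proof.
case=> es [et <-] [er [es' <-]]; destruct es, et, er.
by rewrite (Prop_irrelevance es' erefl); exact: heq_refl.
Qed.

Lemma heq_hcompA (A B C D : obj K) (r r' : arr C D) (s s' : arr B C)
  (t t' : arr A B) (S : hom2 r r') (T : hom2 s s') (U : hom2 t t') :
  heq (S ⊗ (T ⊗ U)) ((S ⊗ T) ⊗ U).
Proof. by exists (comp1A r s t), (comp1A r' s' t'); exact: (hcompA KP). Qed.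

Lemma heq_unitl (A B : obj K) (r s : arr A B) (S : hom2 r s) :
  heq (unit2 (unit1 B) ⊗ S) S.
Proof. by exists (comp1_unitl r), (comp1_unitl s); exact: (hcomp_unitl KP). Qed.

Lemma heq_unitr (A B : obj K) (r s : arr A B) (S : hom2 r s) :
  heq (S ⊗ unit2 (unit1 A)) S.
Proof. by exists (comp1_unitr r), (comp1_unitr s); exact: (hcomp_unitr KP). Qed.

(** Eckmann-Hilton: inserting units, interchange turns [a ⊗ b] into [(a ⊗ 1) ∘ (1 ⊗ b)]. *)
Lemma heq_hcomp_end (A : obj K) (a b : hom2 (unit1 A) (unit1 A)) :
  heq (a ⊗ b) (a ∘ b).
Proof.
rewrite -{1}(vcomp_unitr KP a) -{1}(vcomp_unitl KP b) (Defs.interchange KP).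
by apply: heq_vcomp; [exact: heq_unitr|exact: heq_unitl].
Qed.

End heterogeneous_equality.

(** * Frobenius reciprocity *)

Section frobenius_reciprocity.
Context {R : realType} {K : two_cstar_category R} {A B : obj K}.
Context {r : arr A B} {rb : arr B A}.
Variables (Rr : hom2 (unit1 A) (rb ⊙ r)) (Rrb : hom2 (unit1 B) (r ⊙ rb)).
Hypothesis hR : conjugation_equations Rr Rrb.
Let KP := two_catP K.

Definition frobenius (T : hom2 r r) : hom2 (unit1 A) (rb ⊙ r) := (unit2 rb ⊗ T) ∘ Rr.

(** With [ev] and [coev], the first conjugation equation reads [ev ∘ coev Rr = unit2 r]; the fixed
    2-arrow E of the outline is [unit2 rb ⊗ ev]. *)
Let ev : hom2 ((r ⊙ rb) ⊙ r) r :=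
  hom2_cast (erefl _) (comp1_unitl r) (Rrb^† ⊗ unit2 r).
Let coev (Y : hom2 (unit1 A) (rb ⊙ r)) : hom2 r ((r ⊙ rb) ⊙ r) :=
  hom2_cast (comp1_unitr r) (comp1A r rb r) (unit2 r ⊗ Y).

Definition frob_inv (Y : hom2 (unit1 A) (rb ⊙ r)) : hom2 r r := ev ∘ coev Y.

(** By interchange [T] slides out of [coev (frobenius T)] and then past [ev]; the first conjugation
    equation disposes of the rest. *)
Lemma frobK : cancel frobenius frob_inv.
Proof.
move=> T.
have coevE : coev (frobenius T) = (unit2 (r ⊙ rb) ⊗ T) ∘ coev Rr.
  apply: heq_eq; apply: heq_trans (heq_cast _ _ _) _.
  rewrite /frobenius -{1}(vcomp_unitl KP (unit2 r)) (Defs.interchange KP) -(hcomp_unit KP).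
  by apply: heq_vcomp (heq_hcompA _ _ _) (heq_sym (heq_cast _ _ _)).
have evE : ev ∘ (unit2 (r ⊙ rb) ⊗ T) = T ∘ ev.
  apply: heq_eq.
  apply: (@heq_trans _ _ _ _ _ _ _ _ _ _ (Rrb^† ⊗ T)).
    apply: heq_trans (heq_vcomp (heq_cast _ _ _) (heq_refl _)) _.
    rewrite -(Defs.interchange KP) (vcomp_unitl KP) (vcomp_unitr KP); exact: heq_refl.
  apply: heq_sym; apply: heq_trans (heq_vcomp (heq_sym (heq_unitl _)) (heq_cast _ _ _)) _.
  rewrite -(Defs.interchange KP) (vcomp_unitl KP) (vcomp_unitr KP); exact: heq_refl.
rewrite /frob_inv coevE (vcompA KP) evE -(vcompA KP).
by have [+ _] := hR; rewrite -/ev -/(coev Rr) => ->; rewrite (vcomp_unitr KP).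
Qed.

(** After reassociation the left side is [(1 ⊗ Y) ∘ (frobenius S ⊗ 1)], which interchange merges.
    Both the inverse of [frobenius] and its behaviour on products rest on this. *)
Lemma coev_frob (Y : hom2 (unit1 A) (rb ⊙ r)) (S : hom2 r r) :
  heq ((unit2 rb ⊗ (coev Y ∘ S)) ∘ Rr) (frobenius S ⊗ Y).
Proof.
rewrite -{1}(vcomp_unitl KP (unit2 rb)) (Defs.interchange KP) -(vcompA KP).
have H1 : heq (unit2 rb ⊗ coev Y) (unit2 (rb ⊙ r) ⊗ Y).
  apply: heq_trans (heq_hcomp (heq_refl _) (heq_cast _ _ _)) _.
  by rewrite -(hcomp_unit KP); exact: heq_hcompA.
apply: heq_trans (heq_vcomp H1 (heq_sym (heq_unitr _))) _.
rewrite -(Defs.interchange KP) (vcomp_unitl KP) (vcomp_unitr KP); exact: heq_refl.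
Qed.

(** Here the second conjugation equation enters, in adjoint form: [(1 ⊗ Rrb^†) ∘ (Rr ⊗ 1)] is the
    identity of [rb]. Interchange moves [Y] to the far right, and this identity cancels what stands
    to its left. *)
Lemma frob_invK : cancel frob_inv frobenius.
Proof.
move=> Y; rewrite /frobenius /frob_inv.
rewrite -{1}(vcomp_unitl KP (unit2 rb)) (Defs.interchange KP) -(vcompA KP).
have H1 : heq ((unit2 rb ⊗ coev Y) ∘ Rr)
    (((Rr ⊗ unit2 rb) ⊗ unit2 r) ∘
     hom2_cast erefl (comp1A (unit1 A) rb r) (unit2 (unit1 A) ⊗ Y)).
  have := coev_frob Y (unit2 r); rewrite (vcomp_unitr KP) => /heq_trans; apply.
  rewrite /frobenius (hcomp_unit KP) (vcomp_unitl KP).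
  rewrite -{1}(vcomp_unitr KP Rr) -{1}(vcomp_unitl KP Y) (Defs.interchange KP).
  apply: heq_vcomp (heq_sym (heq_cast _ _ _)).
  rewrite -(hcomp_unit KP); exact: heq_hcompA.
pose Q := hom2_cast (comp1A rb r rb) erefl (unit2 rb ⊗ Rrb^†).
have QE : heq (unit2 rb ⊗ Rrb^†) Q by exact: heq_sym (heq_cast _ _ _).
have H2 : heq (unit2 rb ⊗ ev) (Q ⊗ unit2 r).
  apply: heq_trans (heq_hcomp (heq_refl _) (heq_cast _ _ _)) _.
  by apply: heq_trans (heq_hcompA _ _ _) (heq_hcomp QE (heq_refl _)).
have H3 : heq (unit2 rb) (Q ∘ (Rr ⊗ unit2 rb)).
  have [_ /(congr1 (fun S => S^†))] := hR.
  rewrite star_unit (star_vcomp KP) => E; rewrite -[X in heq X _]E.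
  apply: heq_vcomp.
    apply: heq_trans (heq_star (heq_cast _ _ _)) _.
    by rewrite (star_hcomp KP) star_unit.
  apply: heq_trans (heq_star (heq_cast _ _ _)) _.
  rewrite (star_hcomp KP) star_unit (starK KP); exact: heq_refl.
apply: heq_eq; apply: heq_trans (heq_vcomp H2 H1) _.
rewrite (vcompA KP) -(Defs.interchange KP) (vcomp_unitl KP).
apply: heq_trans (heq_vcomp (heq_hcomp (heq_sym H3) (heq_refl _))
  (heq_trans (heq_cast _ _ _) (heq_unitl _))) _.
rewrite (hcomp_unit KP) (vcomp_unitl KP); exact: heq_refl.
Qed.

(** [Z] is [frobenius S ⊗ frobenius T] up to transport. Hence [Z^† ∘ Z] is a horizontal product of
    two elements of End(iota_A), which equals their vertical product. *)
Lemma frob_vcomp (T S : hom2 r r) :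
  exists Z, [/\ frobenius (T ∘ S) = (unit2 rb ⊗ ev) ∘ Z &
    heq (Z^† ∘ Z) (((frobenius S)^† ∘ frobenius S) ∘ ((frobenius T)^† ∘ frobenius T))].
Proof.
exists ((unit2 rb ⊗ (coev (frobenius T) ∘ S)) ∘ Rr); split.
  rewrite /frobenius -{1}(frobK T) /frob_inv -(vcompA KP).
  by rewrite -{1}(vcomp_unitl KP (unit2 rb)) (Defs.interchange KP) -(vcompA KP).
have H := coev_frob (frobenius T) S.
apply: heq_trans (heq_vcomp (heq_star H) H) _.
rewrite (star_hcomp KP) -(Defs.interchange KP); exact: heq_hcomp_end.
Qed.

End frobenius_reciprocity.

(** If [P setT] failed, the complements of the sets satisfying [P] would form a proper filter, and a
    neighbourhood satisfying [P] of a cluster point would meet its own complement. *)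
Lemma compact_induction (T : topologicalType) (P : set T -> Prop) :
  compact [set: T] -> P set0 -> (forall A B, P A -> P B -> P (A `|` B)) ->
  (forall A B, A `<=` B -> P B -> P A) ->
  (forall x : T, exists2 U, nbhs x U & P U) -> P setT.
Proof.
move=> cT P0 PU Psub Ploc; apply: contrapT => nP.
pose F : set_system T := [set A | P (~` A)].
have FF : ProperFilter F.
  split; first by rewrite /F /= setC0.
  split.
  - by rewrite /F /= setCT.
  - by move=> A B PA PB; rewrite /F /= setCI; exact: PU.
  - by move=> A B AB; apply: Psub; exact: subsetC.
have [x [_ xF]] := cT F FF (filterT : F setT).
have [U xU UP] := Ploc x.
have FU : F (~` U) by rewrite /F /= setCK.
by have [y []] := xF _ _ FU xU.
Qed.

(** * Evaluating End(iota_A) at points of [Omega] *)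

Section gelfand.
Context {R : realType} {K : two_cstar_category R} {A : obj K}.
Context {Omega : topologicalType}.
Variable g : gelfand_identification A Omega.
Let KP := two_catP K.
Implicit Types (S T : hom2 (unit1 A) (unit1 A)) (w : Omega).

Lemma gelfandD S T w : g (S + T) w = g S w + g T w.
Proof. by have := gelfand_linear g 1 S T w; rewrite scale1r mul1r. Qed.

Lemma gelfand0 w : g 0 w = 0.
Proof. by apply: (addrI (g 0 w)); rewrite -gelfandD !addr0. Qed.

Lemma gelfandZ a S w : g (a *: S) w = a * g S w.
Proof. by have := gelfand_linear g a S 0 w; rewrite gelfand0 !addr0. Qed.

Lemma gelfandB S T w : g (S - T) w = g S w - g T w.
Proof. by rewrite gelfandD -scaleN1r gelfandZ mulN1r. Qed.

Lemma gelfand_continuous S : continuous (g S : Omega -> R[i]^o).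
Proof. by have [H _ _] := gelfand_bij g; exact: (H S). Qed.

Lemma gelfand_surj (f : Omega -> R[i]^o) : continuous f -> exists S, forall w, g S w = f w.
Proof.
by have [_ _ H] := gelfand_bij g => /H [S _ <-]; exists S.
Qed.

Lemma gelfand_near S w (e : R) : 0 < e ->
  \forall w' \near w, rnorm (g S w' - g S w) < e.
Proof.
move=> e0; have /cvgrPdist_lt/(_ e%:C%C) := @gelfand_continuous S w.
rewrite ltcR => /(_ e0); apply: filterS => w'.
by rewrite [`|_|]rnormE ltcR (@rnormB _ R[i]^o).
Qed.

Lemma gelfand_Re_continuous S : continuous (fun w => complex.Re (g S w) : R).
Proof.
move=> w; apply/cvgrPdist_lt => e /(gelfand_near S w); apply: filterS => w'.
apply: le_lt_trans; rewrite distrC -raddfB; exact: rnorm_Re.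
Qed.

Lemma gelfand_rnorm_sup S c : 0 <= c -> (forall w, rnorm (g S w) <= c) -> rnorm S <= c.
Proof.
move=> c0 H; rewrite (gelfand_norm g).
(* When [Omega] is empty, the supremum is that of the empty set, which is 0 by convention. *)
have [->|/set0P E0] := eqVneq [set rnorm (g S w) | w in setT] set0.
  by rewrite sup0.
by apply: ge_sup => // _ [w _ <-].
Qed.

Hypothesis cO : compact [set: Omega].

(** [sup] dominates the members of a set only if the set is bounded above; compactness and local
    boundedness give the bound. *)
Lemma gelfand_rnorm_le S w : rnorm (g S w) <= rnorm S.
Proof.
rewrite (gelfand_norm g S); apply: ub_le_sup; last by exists w.
suff [M HM] : exists M, forall w', setT w' -> rnorm (g S w') <= M.
  by exists M => _ [w' _ <-]; exact: HM.
apply: (@compact_induction _ (fun X => exists M, forall w', X w' -> rnorm (g S w') <= M)) => //.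
- by exists 0.
- move=> X Y [M HM] [N HN]; exists (Num.max M N) => w' [/HM|/HN] H.
    by rewrite le_max H.
  by rewrite le_max H orbT.
- by move=> X Y XY [M HM]; exists M => w' /XY/HM.
- move=> w0; exists [set w' | rnorm (g S w' - g S w0) < 1].
    exact: gelfand_near.
  exists (1 + rnorm (g S w0)) => w' /ltW H.
  by apply: le_trans (@rnorm_leB _ R[i]^o _ (g S w0)) _; rewrite lerD2r.
Qed.

(** This is the operator inequality $Z^*E^*EZ \le C\,Z^*Z$. With [y] a selfadjoint square root of $1
    - C^{-1}E^*E$, the difference $Z^*Z - C^{-1}(EZ)^*(EZ)$ equals $(yZ)^*(yZ)$, hence is positive
    at each point. *)
Lemma gelfand_star_vcomp_le (s t : arr A A) (E : hom2 s t) :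
  exists2 C : R, 0 < C & forall (Z : hom2 (unit1 A) s) w,
    complex.Re (g ((E ∘ Z)^† ∘ (E ∘ Z)) w) <= C * complex.Re (g (Z^† ∘ Z) w).
Proof.
(* The factor 2 brings [C^-1 *: (E^† ∘ E)] into the ball of radius 1/2 required by
   [selfadjoint_sqrt]; the summand 1 keeps [C] positive. *)
pose C := 2 * rnorm (E^† ∘ E) + 1.
have C0 : 0 < C by rewrite ltr_wpDl // mulr_ge0 // rnorm_ge0.
exists C => // Z w; pose x := (C^-1)%:C%C *: (E^† ∘ E).
have xs : x^† = x.
  by rewrite starZ (star_vcomp KP) (starK KP) /= oppr0.
have [|y [ys yy]] := selfadjoint_sqrt xs.
  rewrite rnormZ rnorm_real ger0_norm ?invr_ge0 ?(ltW C0) // mulrC ler_pdivrMr //.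
  rewrite /C mulrDr mulrA mulVf // mul1r lerDl; lra.
have : 0 <= g ((y ∘ Z)^† ∘ (y ∘ Z)) w.
  exact/gelfand_positive/(star_vcomp_positive KP).
have -> : (y ∘ Z)^† ∘ (y ∘ Z) =
    Z^† ∘ Z - (C^-1)%:C%C *: ((E ∘ Z)^† ∘ (E ∘ Z)).
  rewrite !(star_vcomp KP) ys (vcompA KP) -(vcompA KP _ y y) yy.
  rewrite vcompBr vcompBl (vcomp_unitr KP) vcompZr vcompZl.
  by rewrite !(vcompA KP).
rewrite gelfandB gelfandZ; set p := g _ w; set q := g _ w.
case: p => p1 p2; case: q => q1 q2; rewrite lecE /= => /andP[_].
by rewrite mul0r subr0 subr_ge0 ler_pdivrMl.
Qed.

End gelfand.

Lemma continuous_max_cst (R : realType) (T : topologicalType) (c : R) (f : T -> R) :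
  continuous f -> continuous (fun x => Num.max c (f x)).
Proof.
move=> cf x; apply/cvgrPdist_lt => e e0.
have /cvgrPdist_lt/(_ _ e0) := cf x; apply: filterS => y.
rewrite !ltr_norml => /andP[H1 H2].
by case: (leP c (f x)) => ?; case: (leP c (f y)) => ?; apply/andP; split; lra.
Qed.

(** * The seminorms of the fibres and lifting from a fibre *)

Section fibre_seminorm.
Context {R : realType} {K : two_cstar_category R} {A B : obj K}.
Context {r : arr A B} {rb : arr B A}.
Variables (Rr : hom2 (unit1 A) (rb ⊙ r)) (Rrb : hom2 (unit1 B) (r ⊙ rb)).
Hypothesis hR : conjugation_equations Rr Rrb.
Context {Omega : topologicalType}.
Hypothesis cO : compact [set: Omega].
Variable g : gelfand_identification A Omega.
Let KP := two_catP K.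
Implicit Types (S T : hom2 r r) (w : Omega).

Local Notation frob := (frobenius Rr).

Definition fibre_norm w T : R := seminorm (end_sip Rr g w) T.
Local Notation sn := fibre_norm.

Lemma frobZ a T : frob (a *: T) = a *: frob T.
Proof.
rewrite /frobenius; have H0 : unit2 rb ⊗ (0 : hom2 r r) = 0.
  apply: (addrI (unit2 rb ⊗ (0 : hom2 r r))).
  by have := hcomp_linearr KP (unit2 rb) 1 (0 : hom2 r r) 0; rewrite !scale1r !addr0.
by have := hcomp_linearr KP (unit2 rb) a T 0; rewrite H0 !addr0 => ->; rewrite vcompZl.
Qed.

Lemma frobD S T : frob (S + T) = frob S + frob T.
Proof.
by have := hcomp_linearr KP (unit2 rb) 1 S T; rewrite !scale1r /frobenius => ->; rewrite vcompDl.
Qed.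

Lemma frobB S T : frob (S - T) = frob S - frob T.
Proof. by rewrite frobD -scaleN1r frobZ scaleN1r. Qed.

Lemma end_innerE S T : end_inner Rr T S = (frob S)^† ∘ frob T.
Proof.
rewrite /end_inner /frobenius (star_vcomp KP) (star_hcomp KP) star_unit.
rewrite [RHS](vcompA KP) -[in RHS](vcompA KP Rr^†) -(Defs.interchange KP).
by rewrite (vcomp_unitl KP).
Qed.

Lemma fibre_norm_sqr w T : sn w T ^+ 2 = complex.Re (g ((frob T)^† ∘ frob T) w).
Proof. by rewrite /sn seminorm_sqr -end_innerE. Qed.

Lemma fibre_normE w T : (sn w T ^+ 2)%:C%C = g ((frob T)^† ∘ frob T) w.
Proof.
rewrite fibre_norm_sqr RRe_real // ger0_real //.
exact/gelfand_positive/(star_vcomp_positive KP).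
Qed.

Lemma fibre_norm_ge0 w T : 0 <= sn w T.
Proof. exact: seminorm_ge0. Qed.

Lemma fibre_normD w S T : sn w (S + T) <= sn w S + sn w T.
Proof. exact: seminormD. Qed.

Lemma fibre_normZ w a T : sn w (a *: T) = rnorm a * sn w T.
Proof. exact: seminormZ. Qed.

Lemma fibre_normB w S T : sn w (S - T) = sn w (T - S).
Proof. exact: seminormB. Qed.

Lemma fibre_norm0 w : sn w 0 = 0.
Proof. exact: seminorm0. Qed.

Lemma fibre_norm_tri w S T U : sn w (S - U) <= sn w (S - T) + sn w (T - U).
Proof. by rewrite -{1}(subrKA T) fibre_normD. Qed.

Lemma fibre_norm_congr w S T : sn w (S - T) = 0 -> sn w S = sn w T.
Proof.
move=> E; apply/le_anti; have := ler_seminormB (end_sip Rr g w) S T.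
have := ler_seminormB (end_sip Rr g w) T S.
by rewrite -!/(sn w _) (fibre_normB w T S) E !add0r => -> ->.
Qed.

Lemma fibre_norm_le_rnorm w T : sn w T <= rnorm (frob T).
Proof.
rewrite -ler_sqr ?nnegrE ?fibre_norm_ge0 ?rnorm_ge0 // fibre_norm_sqr.
apply: le_trans (ler_norm _) _; apply: le_trans (rnorm_Re _) _.
by rewrite -rnorm_star_vcomp gelfand_rnorm_le.
Qed.

Lemma rnorm_frob_le T c : 0 <= c -> (forall w, sn w T <= c) -> rnorm (frob T) <= c.
Proof.
move=> c0 H; rewrite -ler_sqr ?nnegrE ?rnorm_ge0 // -rnorm_star_vcomp.
apply: (gelfand_rnorm_sup (g := g)) => [|w]; first exact: sqr_ge0.
rewrite -fibre_normE rnorm_real ger0_norm ?sqr_ge0 //.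
by rewrite ler_sqr ?nnegrE ?fibre_norm_ge0.
Qed.

Lemma fibre_norm_separates S T : (forall w, sn w (S - T) = 0) -> S = T.
Proof.
move=> H; apply: (can_inj (frobK hR)); apply/eqP; rewrite -subr_eq0 -frobB.
apply/eqP/rnorm_eq0/le_anti; rewrite rnorm_ge0 andbT.
by apply: rnorm_frob_le => // w; rewrite H.
Qed.

(** The bound is uniform in [w], so it is a bound in the Banach space Hom(iota_A, rb ⊙ r); the limit
    found there is carried back by [frob_inv]. *)
Lemma fibre_norm_complete (T : nat -> hom2 r r) C : 0 <= C ->
  (forall n w, sn w (T n.+1 - T n) <= C * 2^-1 ^+ n) ->
  exists L, forall n w, sn w (T n - L) <= 2 * C * 2^-1 ^+ n.
Proof.
move=> C0 H; have [|Y HY] := @geometric_cvg _ _ (fun n => frob (T n)) C.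
  move=> n; rewrite -frobB; apply: rnorm_frob_le => //.
  by rewrite mulr_ge0 // exprn_ge0 // invr_ge0.
exists (frob_inv Rrb Y) => n w; apply: le_trans (fibre_norm_le_rnorm _ _) _.
by rewrite frobB (frob_invK hR).
Qed.

(** Apply [gelfand_star_vcomp_le] to E = [unit2 rb ⊗ ev], so that the constant does not depend on
    [w]; [g] is multiplicative, so [Z^† ∘ Z] evaluates to the product of the squared seminorms.
    Adding 1 to [Num.sqrt C] secures [1 <= M]. *)
Lemma fibre_norm_vcomp : exists2 M : R, 1 <= M & forall w S T,
  sn w (T ∘ S) <= M * sn w T * sn w S.
Proof.
have [C C0 HC] := gelfand_star_vcomp_le g
  (unit2 rb ⊗ hom2_cast (erefl _) (comp1_unitl r) (Rrb^† ⊗ unit2 r)).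
have M0 : 0 <= Num.sqrt C + 1 by rewrite addr_ge0 ?sqrtr_ge0.
exists (Num.sqrt C + 1) => [|w S T]; first by rewrite lerDr sqrtr_ge0.
rewrite -ler_sqr ?nnegrE ?mulr_ge0 ?fibre_norm_ge0 //.
have [Z [E1 /heq_eq E2]] := frob_vcomp hR T S.
rewrite fibre_norm_sqr E1; apply: le_trans (HC _ _) _.
rewrite E2 gelfand_vcomp -!fibre_normE -rmorphM /= !exprMn.
rewrite [X in C * X]mulrC mulrA !ler_wpM2r ?sqr_ge0 //.
rewrite -{1}(sqr_sqrtr (ltW C0)) ler_sqr ?nnegrE ?sqrtr_ge0 //.
by rewrite lerDl.
Qed.

Lemma fibre_norm_near w T (e : R) : 0 < e ->
  \forall w' \near w, `|sn w' T - sn w T| < e.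
Proof.
move=> e0; have := @continuous_comp _ _ _ _ (@Num.sqrt R) w
  (@gelfand_Re_continuous _ _ _ _ g ((frob T)^† ∘ frob T) w) (@sqrt_continuous R _).
move=> /cvgrPdist_lt/(_ e e0); apply: filterS => w' /=.
have E x : Num.sqrt (complex.Re (g ((frob T)^† ∘ frob T) x)) = sn x T.
  by rewrite -fibre_norm_sqr sqrtr_sqr ger0_norm ?fibre_norm_ge0.
by rewrite !E distrC.
Qed.

Lemma fibre_norm_continuous T : continuous (fun w => sn w T : R).
Proof.
move=> w; apply/cvgrPdist_lt => e /(fibre_norm_near w T).
by apply: filterS => w'; rewrite distrC.
Qed.

(** [f] is the transform of some [a] in End(iota_A), which acts on the right of [frob T]. At [w] the
    error is [frob T ∘ (a - f w)], and [g] sends the last factor to 0 there. *)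
Lemma fibre_module (f : Omega -> R) T : continuous f ->
  exists T', forall w, sn w (T' - (f w)%:C%C *: T) = 0.
Proof.
move=> cf; have [|a Ha] := @gelfand_surj _ _ _ _ g (fun w => (f w)%:C%C).
  move=> w; apply/cvgrPdist_lt => e e0.
  have re0 : 0 < complex.Re e by move: e0; rewrite ltcE => /andP[].
  have /cvgrPdist_lt/(_ _ re0) := cf w; apply: filterS => w' H.
  rewrite -[(f w)%:C%C - _]rmorphB [`|_|]rnormE rnorm_real ltcE /= H andbT.
  by move: e0; rewrite ltcE => /andP[].
exists (frob_inv Rrb (frob T ∘ a)) => w; apply/eqP.
rewrite -(sqrf_eq0) fibre_norm_sqr frobB (frob_invK hR) frobZ.
have -> : frob T ∘ a - (f w)%:C%C *: frob T =
    frob T ∘ (a - (f w)%:C%C *: unit2 (unit1 A)).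
  by rewrite vcompBr vcompZr (vcomp_unitr KP).
rewrite (vcompA KP) gelfand_vcomp gelfandB gelfandZ gelfand_unit Ha mulr1 subrr.
by rewrite mulr0.
Qed.

Lemma fibre_cutoff w T (e : R) : 0 < e -> sn w T <= e ->
  exists T', sn w (T' - T) = 0 /\ forall w', sn w' T' <= e.
Proof.
(* The factor [f] equals 1 at [w], because [sn w T <= e]. *)
move=> e0 H; pose f w' := e / Num.max e (sn w' T).
have m0 w' : 0 < Num.max e (sn w' T) by rewrite lt_max e0.
have [|T' HT'] := @fibre_module f T.
  move=> w'; apply: cvgM; first exact: cvg_cst.
  apply: cvgV; first by rewrite gt_eqF.
  exact: (continuous_max_cst (fibre_norm_continuous (T := T)) (c := e)).
exists T'; split.
  have := HT' w; rewrite /f (_ : Num.max _ _ = e) ?divff ?scale1r ?gt_eqF //.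
  exact/max_idPl.
move=> w'; rewrite (fibre_norm_congr (HT' w')) fibre_normZ rnorm_real.
rewrite ger0_norm ?divr_ge0 ?(ltW e0) ?(ltW (m0 _)) // mulrAC -mulrA.
by rewrite ler_piMr ?(ltW e0) // ler_pdivrMr // mul1r le_max lexx orbT.
Qed.

(** Approximants [S n] of [v] have small successive differences at [w] only. [fibre_cutoff] replaces
    these by [D n], equal to them in the fibre at [w] and small in every fibre, so the partial sums
    [P n] converge uniformly and agree with [S n] at [w]. *)
Lemma to_completion_surj w (v : completion (end_sip Rr g w)) :
  exists T, v = to_completion _ T.
Proof.
set Q := end_sip Rr g w.
have e0 n : 0 < 2^-1 ^+ n :> R by rewrite exprn_gt0 // invr_gt0.
have /choice[S HS] n : exists S, rnorm (v - to_completion Q S) <= 2^-1 ^+ n.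
  exact: to_completion_dense_norm.
have snE T U : sn w (T - U) = rnorm (to_completion Q T - to_completion Q U).
  by rewrite -linearB /rnorm norm_to_completion.
have tri (a b c : completion Q) : rnorm (a - c) <= rnorm (a - b) + rnorm (b - c).
  exact: rnorm_tri.
have SS n : sn w (S n.+1 - S n) <= 2 * 2^-1 ^+ n.
  rewrite snE; have := tri (to_completion Q (S n.+1)) v (to_completion Q (S n)).
  have := HS n; have := HS n.+1; rewrite exprS (rnormB _ v); have := e0 n; lra.
have /choice[D HD] n : exists T', sn w (T' - (S n.+1 - S n)) = 0 /\
    forall w', sn w' T' <= 2 * 2^-1 ^+ n.
  by apply: fibre_cutoff (SS n); rewrite mulr_gt0.
pose P n := S 0%N + \sum_(i < n) D i.
have PS n : sn w (P n - S n) = 0.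
  elim: n => [|n IH]; first by rewrite /P big_ord0 addr0 subrr fibre_norm0.
  have [H _] := HD n; apply/le_anti; rewrite fibre_norm_ge0 andbT.
  rewrite -[leRHS](addr0 0) -{1}IH -{1}H.
  have -> : P n.+1 - S n.+1 = (P n - S n) + (D n - (S n.+1 - S n)).
    rewrite /P big_ord_recr /= addrA -/(P n).
    by rewrite opprB [RHS]addrCA subrKA addrA (addrC (D n)).
  exact: fibre_normD.
have [//|n w'|L HL] := @fibre_norm_complete P 2.
  have -> : P n.+1 - P n = D n.
    by rewrite {1}/P big_ord_recr /= addrA -/(P n) [LHS]addrC addKr.
  exact: (HD n).2.
exists L; apply/eqP; rewrite -subr_eq0; apply/eqP/rnorm_eq0/le_anti.
(* The 5 is 1 from [v] to [S n], 0 from [S n] to [P n], and 4 from [P n] to [L]. *)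
rewrite rnorm_ge0 andbT; apply: (@le_half_expr _ _ 5) => n.
have := tri v (to_completion Q (S n)) (to_completion Q L); rewrite -snE.
have := HS n; have := HL n w; have := fibre_norm_tri w (S n) (P n) L.
by rewrite (fibre_normB w (S n) (P n)) PS; lra.
Qed.

End fibre_seminorm.

(** * The GNS representation and its operator norm *)

Section gns_representation.
Context {R : realType} {K : two_cstar_category R} {A B : obj K}.
Context {r : arr A B} {rb : arr B A}.
Variables (Rr : hom2 (unit1 A) (rb ⊙ r)) (Rrb : hom2 (unit1 B) (r ⊙ rb)).
Hypothesis hR : conjugation_equations Rr Rrb.
Context {Omega : topologicalType}.
Hypothesis cO : compact [set: Omega].
Variable g : gelfand_identification A Omega.
Let KP := two_catP K.
Implicit Types (S T U : hom2 r r) (w : Omega).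

Local Notation sn := (fibre_norm Rr g).
Local Notation "'to' w" := (to_completion (end_sip Rr g w)) (at level 10, w at level 8).

Lemma rnorm_to w T : rnorm (to w T) = sn w T.
Proof. by rewrite /rnorm norm_to_completion. Qed.

Lemma to_eqP w S T : to w S = to w T <-> sn w (S - T) = 0.
Proof.
split=> [E|E]; first by rewrite -rnorm_to linearB /= E subrr rnorm0.
by apply/eqP; rewrite -subr_eq0 -linearB; apply/eqP/rnorm_eq0; rewrite rnorm_to.
Qed.

(** The default value of [xget] is excluded by building an operator: multiply a chosen preimage by
    [T]. By [fibre_norm_vcomp] null elements go to null elements, so the choice does not matter, and
    the same bound gives continuity. *)
Lemma gnsP w T : [/\ linear (gns Rr g w T), continuous (gns Rr g w T) &
  forall S, gns Rr g w T (to w S) = to w (T ∘ S)].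
Proof.
rewrite /gns; case: xgetP => [f _ //|H]; exfalso.
have /choice[pre Hpre] := to_completion_surj hR cO (g := g) (w := w).
pose f x := to w (T ∘ pre x).
have [M M1 HM] := fibre_norm_vcomp hR g.
have M0 : 0 <= M by apply: le_trans M1.
have fto S : f (to w S) = to w (T ∘ S).
  apply/to_eqP; rewrite -vcompBr; apply/le_anti; rewrite fibre_norm_ge0 andbT.
  apply: le_trans (HM _ _ _) _.
  by have /esym/to_eqP -> := Hpre (to w S); rewrite mulr0.
have fl : linear f.
  move=> a x y; rewrite [x]Hpre [y]Hpre -linearP !fto vcompDr vcompZr.
  by rewrite linearP.
have fb x : rnorm (f x) <= M * sn w T * rnorm x.
  by rewrite [x]Hpre fto !rnorm_to.
apply: (H f); split=> // x; apply/(@cvgrPdist_lt _ _ _ (nbhs x)) => e e0.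
have re0 : 0 < complex.Re e by move: e0; rewrite ltcE => /andP[].
pose C := M * sn w T + 1.
have C0 : 0 < C by rewrite ltr_wpDl // mulr_ge0 // fibre_norm_ge0.
apply/nbhs_normP; exists (complex.Re e / C)%:C%C; first by rewrite /= ltcR divr_gt0.
move=> y /=; rewrite rnormE ltcR => H1.
rewrite rnormE ltcE /=; apply/andP; split.
  by move: e0; rewrite ltcE => /andP[].
have -> : f x - f y = f (x - y).
  by rewrite addrC -scaleN1r -fl scaleN1r addrC.
apply: le_lt_trans (fb _) _; apply: (@le_lt_trans _ _ (C * rnorm (x - y))).
  by rewrite ler_wpM2r ?rnorm_ge0 // lerDl.
by rewrite mulrC -ltr_pdivlMr.
Qed.

Lemma gns_to w T S : gns Rr g w T (to w S) = to w (T ∘ S).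
Proof. by have [_ _] := gnsP w T. Qed.

Lemma gns_linear w T a x y : gns Rr g w T (a *: x + y) =
  a *: gns Rr g w T x + gns Rr g w T y.
Proof. by have [H _ _] := gnsP w T; exact: H. Qed.

Lemma gns_ext w (f h : end_hilbert Rr g w -> end_hilbert Rr g w) :
  (forall S, f (to w S) = h (to w S)) -> f = h.
Proof.
move=> H; apply/funext => x; have [S ->] := to_completion_surj hR cO x; exact: H.
Qed.

Lemma gnsL w a S T : gns Rr g w (a *: S + T) = a *: gns Rr g w S + gns Rr g w T.
Proof.
apply: gns_ext => U; rewrite -[RHS]/(a *: gns Rr g w S (to w U) + gns Rr g w T (to w U)).
by rewrite !gns_to vcompDl vcompZl linearP.
Qed.

Lemma gns0 w : gns Rr g w 0 = 0.
Proof.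
apply: (addrI (gns Rr g w 0)); rewrite addr0.
by have := gnsL w 1 0 0; rewrite !scale1r addr0.
Qed.

Lemma gnsB w S T : gns Rr g w (S - T) = gns Rr g w S - gns Rr g w T.
Proof. by rewrite addrC -scaleN1r gnsL scaleN1r addrC. Qed.

Lemma gns_comp w S T : gns Rr g w S \o gns Rr g w T = gns Rr g w (S ∘ T).
Proof. by apply: gns_ext => U /=; rewrite !gns_to (vcompA KP). Qed.

Lemma gns_adjoint_form w T x y :
  completion_form (gns Rr g w T x) y = completion_form x (gns Rr g w T^† y).
Proof.
have [S ->] := to_completion_surj hR cO x; have [U ->] := to_completion_surj hR cO y.
rewrite !gns_to !to_completionE /= /end_inner_at /end_inner.
by rewrite (star_vcomp KP) (starK KP) (vcompA KP).
Qed.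

Lemma completion_form_inj (V : lmodType R[i]) (Q : @semi_inner_product R V)
  (x y : completion Q) :
  (forall z, completion_form z x = completion_form z y) -> x = y.
Proof.
move=> H; apply/eqP; rewrite -subr_eq0; apply/eqP; apply: completion_form_eq0.
have -> : completion_form (x - y) (x - y) =
    completion_form (x - y) x - completion_form (x - y) y by exact: linearBr.
by rewrite H subrr.
Qed.

Lemma adjoint_gns w T : adjoint (gns Rr g w T) = gns Rr g w T^†.
Proof.
rewrite /adjoint; case: xgetP => [h _ Hh|/(_ (gns Rr g w T^†))]; last first.
  by case=> x y; exact: gns_adjoint_form.
apply/funext => y; apply: completion_form_inj => x.
by rewrite -Hh gns_adjoint_form.
Qed.

Definition gns_norm w T : R := opnorm (gns Rr g w T).

Lemma gns_bound w T : exists2 C, 0 <= C & forall x, rnorm (gns Rr g w T x) <= C * rnorm x.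
Proof.
have [M M1 HM] := fibre_norm_vcomp hR g.
exists (M * sn w T) => [|y].
  by rewrite mulr_ge0 ?fibre_norm_ge0 // (le_trans _ M1).
have [S ->] := to_completion_surj hR cO y; rewrite gns_to !rnorm_to; exact: HM.
Qed.

Lemma gns_map0 w T : gns Rr g w T 0 = 0.
Proof.
have := gns_linear (w := w) T 1 0 0; rewrite !scale1r addr0 -{1}[gns Rr g w T 0]addr0.
by move=> /addrI <-.
Qed.

Lemma gns_has_ubound w T :
  has_ubound [set rnorm (gns Rr g w T x) | x in [set x | rnorm x <= 1]].
Proof.
have [C C0 HC] := gns_bound w T; exists C => _ [y /= y1 <-].
by apply: le_trans (HC y) _; rewrite ler_piMr.
Qed.

Lemma gns_norm_ge0 w T : 0 <= gns_norm w T.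
Proof.
apply: ub_le_sup; first exact: gns_has_ubound.
by exists 0 => /=; rewrite ?gns_map0 rnorm0.
Qed.

Lemma gns_norm_le w T c : 0 <= c ->
  (forall x, rnorm (gns Rr g w T x) <= c * rnorm x) -> gns_norm w T <= c.
Proof.
move=> c0 H; apply: ge_sup; first by exists (rnorm (gns Rr g w T 0)), 0 => //=; rewrite rnorm0.
by move=> _ [x /= x1 <-]; apply: le_trans (H x) _; rewrite ler_piMr.
Qed.

Lemma gns_norm_ub w T x : rnorm (gns Rr g w T x) <= gns_norm w T * rnorm x.
Proof.
have g0 := gns_map0 w T.
have [/rnorm_eq0 ->|x0] := eqVneq (rnorm x) 0; first by rewrite g0 !rnorm0 mulr0.
have {}x0 : 0 < rnorm x by rewrite lt_neqAle rnorm_ge0 eq_sym x0.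
pose a := ((rnorm x)^-1)%:C%C.
have na : rnorm a = (rnorm x)^-1 by rewrite rnorm_real ger0_norm // invr_ge0 ltW.
have : rnorm (gns Rr g w T (a *: x)) <= gns_norm w T.
  apply: ub_le_sup; first exact: gns_has_ubound.
  by exists (a *: x) => //=; rewrite rnormZ na mulVf // gt_eqF.
have := gns_linear T a x 0; rewrite !addr0 g0 addr0 => ->.
by rewrite rnormZ na mulrC ler_pdivrMr.
Qed.

Lemma gns_norm_le_fibre : exists2 M : R, 0 < M & forall w T, gns_norm w T <= M * sn w T.
Proof.
have [M M1 HM] := fibre_norm_vcomp hR g.
have M0 : 0 < M by apply: lt_le_trans M1.
exists M => // w T; apply: gns_norm_le => [|x]; first by rewrite mulr_ge0 ?fibre_norm_ge0 // ltW.
have [S ->] := to_completion_surj hR cO x; rewrite gns_to !rnorm_to; exact: HM.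
Qed.

(** Apply the operator of [T] to the class of [unit2 r], whose norm in every fibre is at most
    [rnorm (frobenius Rr (unit2 r))]. *)
Lemma fibre_norm_le_gns : exists2 m : R, 0 < m & forall w T, sn w T <= m * gns_norm w T.
Proof.
pose m := rnorm (frobenius Rr (unit2 r)) + 1.
have m0 : 0 < m by rewrite ltr_wpDl // rnorm_ge0.
exists m => // w T; rewrite -rnorm_to -{1}(vcomp_unitr KP T) -gns_to.
apply: le_trans (gns_norm_ub _ _) _; rewrite mulrC ler_wpM2r ?gns_norm_ge0 //.
by rewrite rnorm_to; apply: le_trans (fibre_norm_le_rnorm Rr cO g _ _) _; rewrite lerDl.
Qed.

Lemma gns_congr w S T : sn w (S - T) = 0 -> gns Rr g w S = gns Rr g w T.
Proof.
move=> E; apply/eqP; rewrite -subr_eq0 -gnsB; apply/eqP/funext => x.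
have [M _ HM] := gns_norm_le_fibre; apply: rnorm_eq0; apply/le_anti.
rewrite rnorm_ge0 andbT; apply: le_trans (gns_norm_ub _ _) _.
rewrite -(mul0r (rnorm x)) ler_wpM2r ?rnorm_ge0 //.
by apply: le_trans (HM _ _) _; rewrite E mulr0.
Qed.

Lemma gns_norm_eq0 w T : gns_norm w T = 0 -> gns Rr g w T = 0.
Proof.
move=> E; rewrite -(gns0 w); apply: gns_congr; rewrite subr0.
have [m _ Hm] := fibre_norm_le_gns; apply/le_anti.
by rewrite fibre_norm_ge0 andbT (le_trans (Hm _ _)) // E mulr0.
Qed.

Lemma gns_normM w S T : gns_norm w (S ∘ T) <= gns_norm w S * gns_norm w T.
Proof.
apply: gns_norm_le => [|x]; first by rewrite mulr_ge0 ?gns_norm_ge0.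
rewrite -gns_comp /= -mulrA; apply: le_trans (gns_norm_ub _ _) _.
by rewrite ler_wpM2l ?gns_norm_ge0 ?gns_norm_ub.
Qed.

Lemma gns_normD w S T : gns_norm w (S + T) <= gns_norm w S + gns_norm w T.
Proof.
apply: gns_norm_le => [|x]; first by rewrite addr_ge0 ?gns_norm_ge0.
have := gnsL w 1 S T; rewrite !scale1r => ->.
rewrite fctE mulrDl; apply: le_trans (rnormD _ _) _.
by rewrite lerD ?gns_norm_ub.
Qed.

Lemma gns_normZ w a T : gns_norm w (a *: T) = rnorm a * gns_norm w T.
Proof.
have le b S : gns_norm w (b *: S) <= rnorm b * gns_norm w S.
  apply: gns_norm_le => [|x]; first by rewrite mulr_ge0 ?gns_norm_ge0 ?(@rnorm_ge0 _ R[i]^o).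
  have := gnsL w b S 0; rewrite gns0 !addr0 => ->.
  rewrite [(b *: _) x]/(b *: _ x) rnormZ -mulrA.
  by rewrite ler_wpM2l ?gns_norm_ub ?(@rnorm_ge0 _ R[i]^o).
apply/le_anti; rewrite le /=; have [->|a0] := eqVneq a 0.
  by rewrite scale0r (@rnorm0 _ R[i]^o) mul0r gns_norm_ge0.
have := le a^-1 (a *: T); rewrite scalerA mulVf // scale1r => H.
have na : rnorm a != 0 by apply: contra_neq a0 => /(@rnorm_eq0 _ R[i]^o).
have nV : rnorm a^-1 * rnorm a = 1.
  by rewrite -rnormM mulVf //; exact: (rnorm_nat 1).
apply: le_trans (ler_wpM2l (@rnorm_ge0 _ R[i]^o a) H) _.
by rewrite mulrA (mulrC (rnorm a)) nV mul1r.
Qed.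

(** Cauchy-Schwarz applied to $\|\pi(S)x\|^2 = \langle x, \pi(S^*S)x\rangle$ gives [le1]. With
    submultiplicativity it yields [le2], whose instance at [T^†] gives the opposite inequality. *)
Lemma gns_norm_star_vcomp w T : gns_norm w (T^† ∘ T) = gns_norm w T ^+ 2.
Proof.
have le1 S : gns_norm w S ^+ 2 <= gns_norm w (S^† ∘ S).
  rewrite -(sqr_sqrtr (gns_norm_ge0 w (S^† ∘ S))).
  rewrite ler_sqr ?nnegrE ?gns_norm_ge0 ?sqrtr_ge0 //.
  apply: gns_norm_le => [|x]; first exact: sqrtr_ge0.
  rewrite -ler_sqr ?nnegrE ?mulr_ge0 ?rnorm_ge0 ?sqrtr_ge0 //.
  rewrite exprMn [X in _ <= X * _]sqr_sqrtr ?gns_norm_ge0 //.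
  pose Q := completion_sip (end_sip Rr g w).
  rewrite -[leLHS]/(seminorm Q (gns Rr g w S x) ^+ 2) seminorm_sqr.
  have -> : Q (gns Rr g w S x) (gns Rr g w S x) = Q x (gns Rr g w (S^† ∘ S) x).
    by rewrite -gns_comp; exact: gns_adjoint_form.
  apply: le_trans (ler_norm _) _; apply: le_trans (rip_CS Q _ _) _.
  rewrite mulrC expr2 mulrA ler_wpM2r ?seminorm_ge0 //.
  exact: gns_norm_ub.
have le2 S : gns_norm w S <= gns_norm w S^†.
  have [S0|S0] := leP (gns_norm w S) 0; first exact: le_trans S0 (gns_norm_ge0 _ _).
  by have := le_trans (le1 S) (gns_normM w S^† S); rewrite expr2 ler_pM2r.
have H := le2 T^†; rewrite (starK KP) in H.
apply/le_anti; rewrite le1 andbT; apply: le_trans (gns_normM w T^† T) _.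
by rewrite [leRHS]expr2 ler_wpM2r // gns_norm_ge0.
Qed.

End gns_representation.

(** Powers of [c / d] tend to 0, so a constant factor, such as one comparing equivalent norms, is
    eventually absorbed. *)
Lemma expr2n_gap (R : realType) (c d C : R) : 0 <= c -> c < d ->
  exists k, C * c ^+ (2 ^ k) < d ^+ (2 ^ k).
Proof.
move=> c0 cd; have d0 : 0 < d by apply: le_lt_trans cd.
have q1 : `|c / d| < 1 by rewrite ger0_norm ?divr_ge0 ?(ltW d0) // ltr_pdivrMr ?mul1r.
have e0 : 0 < (`|C| + 1)^-1 by rewrite invr_gt0 ltr_wpDl.
have /cvgrPdist_lt/(_ _ e0)[N _ HN] := cvg_expr q1.
exists N; have /= := HN (2 ^ N)%N (ltnW (ltn_expl N (isT : (1 < 2)%N))).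
rewrite sub0r normrN ger0_norm ?exprn_ge0 ?divr_ge0 ?(ltW d0) // => H.
rewrite -[ltRHS]mul1r -ltr_pdivrMr ?exprn_gt0 // -mulrA -expr_div_n.
apply: le_lt_trans (ler_norm _) _; rewrite normrM (ger0_norm (exprn_ge0 _ (divr_ge0 c0 (ltW d0)))).
apply: (@le_lt_trans _ _ ((`|C| + 1) * (c / d) ^+ (2 ^ N))).
  by rewrite ler_wpM2r ?exprn_ge0 ?divr_ge0 ?(ltW d0) // lerDl.
have C1 : 0 < `|C| + 1 by rewrite ltr_wpDl.
by move: H; rewrite -[X in _ < X]div1r ltr_pdivlMr // mulrC.
Qed.

(** * Continuity of the operator norm, and gluing *)

Section bundle.
Context {R : realType} {K : two_cstar_category R} {A B : obj K}.
Context {r : arr A B} {rb : arr B A}.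
Variables (Rr : hom2 (unit1 A) (rb ⊙ r)) (Rrb : hom2 (unit1 B) (r ⊙ rb)).
Hypothesis hR : conjugation_equations Rr Rrb.
Context {Omega : topologicalType}.
Hypothesis cO : compact [set: Omega].
Variable g : gelfand_identification A Omega.
Let KP := two_catP K.
Implicit Types (S T U : hom2 r r) (w : Omega).

Local Notation sn := (fibre_norm Rr g).
Local Notation nm := (gns_norm Rr g).

(** [P] is $(T^*T)^{2^k}$. It stays selfadjoint, so the $C^*$-identity doubles the exponent at each
    squaring. *)
Lemma gns_norm_expr T k : exists P, forall w, nm w P = nm w T ^+ (2 ^ k.+1).
Proof.
suff [P [_ HP]] : exists P, P^† = P /\ forall w, nm w P = nm w T ^+ (2 ^ k.+1).
  by exists P.
elim: k => [|k [P [Ps HP]]].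
  exists (T^† ∘ T); split; first by rewrite (star_vcomp KP) (starK KP).
  by move=> w; rewrite (gns_norm_star_vcomp hR cO).
exists (P ∘ P); split; first by rewrite (star_vcomp KP) Ps.
move=> w; rewrite -{1}Ps (gns_norm_star_vcomp hR cO) HP -exprM.
by rewrite [in RHS]expnS mulnC.
Qed.

(** The two norms differ by the factors [M] and [m], so continuity of [sn] does not pass to [nm]
    directly. For the power [P], the gap between [c ^+ N] and [d ^+ N] exceeds [M * m], and
    continuity of [sn] at [P] then suffices. *)
Lemma gns_norm_semicontinuous T (c d : R) : 0 <= c -> c < d ->
  forall w, (nm w T <= c -> \forall w' \near w, nm w' T < d) /\
            (d <= nm w T -> \forall w' \near w, c < nm w' T).
Proof.
move=> c0 cd w; have d0 : 0 <= d by apply: le_trans (ltW cd).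
have [M M0 HM] := gns_norm_le_fibre hR cO g.
have [m m0 Hm] := fibre_norm_le_gns hR cO g.
(* Squares are compared because [P] starts from [T^† ∘ T]: the exponent [N] is [2 ^ k0.+1]. *)
have cd2 : c ^+ 2 < d ^+ 2 by rewrite ltr_pXn2r ?nnegrE.
have [k0 gap] := expr2n_gap (M * m) (exprn_ge0 2 c0) cd2.
rewrite -!exprM -expnS in gap; have [P HP] := gns_norm_expr T k0.
set N := (2 ^ k0.+1)%N in gap HP.
have N0 : (0 < N)%N by rewrite expn_gt0.
have X (a b : R) : 0 <= a -> 0 <= b -> (a ^+ N < b ^+ N) = (a < b).
  by move=> a0 b0; rewrite ltr_pXn2r ?nnegrE.
have Xle (a b : R) : 0 <= a -> 0 <= b -> (a ^+ N <= b ^+ N) = (a <= b).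
  by move=> a0 b0; rewrite ler_pXn2r ?nnegrE.
have n0 w' : 0 <= nm w' T by exact: (gns_norm_ge0 hR cO).
split=> H.
- have e0 : 0 < d ^+ N / M - m * c ^+ N.
    by rewrite subr_gt0 ltr_pdivlMr // mulrAC (mulrC m).
  apply: filterS (fibre_norm_near Rr g w P e0) => w' H'.
  rewrite -X // -HP; apply: le_lt_trans (HM _ _) _.
  rewrite mulrC -ltr_pdivlMr //.
  have : sn w P <= m * c ^+ N.
    by apply: le_trans (Hm _ _) _; rewrite HP ler_wpM2l ?(ltW m0) // Xle.
  by move: H'; rewrite ltr_norml => /andP[]; lra.
- have e0 : 0 < d ^+ N / M - m * c ^+ N.
    by rewrite subr_gt0 ltr_pdivlMr // mulrAC (mulrC m).
  apply: filterS (fibre_norm_near Rr g w P e0) => w' H'.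
  rewrite -X // -HP -(ltr_pM2l m0); apply: lt_le_trans (Hm _ _).
  have : d ^+ N / M <= sn w P.
    rewrite ler_pdivrMr // mulrC; apply: le_trans (HM _ _).
    by rewrite HP Xle.
  by move: H'; rewrite ltr_norml => /andP[]; lra.
Qed.

Lemma gns_norm_continuous T : continuous (fun w => nm w T : R).
Proof.
move=> w; apply/cvgrPdist_lt => e e0.
have n0 : 0 <= nm w T by exact: (gns_norm_ge0 hR cO).
have [|H1 _] := @gns_norm_semicontinuous T (nm w T) (nm w T + e) n0 _ w.
  by rewrite ltrDl.
have H2 : \forall w' \near w, nm w T - e < nm w' T.
  (* Semicontinuity asks for a nonnegative lower level; below 0 the bound follows from nonnegativity
     of the norm. *)
  have [h|h] := leP 0 (nm w T - e).
    have [|_ H2] := @gns_norm_semicontinuous T (nm w T - e) (nm w T) h _ w.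
      by rewrite gtrBl.
    exact: H2.
  apply: filterE => w'; apply: lt_le_trans h _; exact: (gns_norm_ge0 hR cO).
apply: filterS2 (H1 (lexx _)) H2 => w' a b.
by rewrite ltr_norml; apply/andP; split; lra.
Qed.

Lemma fibre_norm_sum_le w (s : seq (hom2 r r)) (f : hom2 r r -> hom2 r r) :
  sn w (\sum_(T <- s) f T) <= \sum_(T <- s) sn w (f T).
Proof.
elim/big_rec2: _ => [|T y x _ H]; first by rewrite fibre_norm0.
by apply: le_trans (fibre_normD _ _ _ _ _) _; rewrite lerD2l.
Qed.

Section gluing.
Variable x : Omega -> hom2 r r.
Hypothesis x_local : forall w (e : R), 0 < e -> exists T,
  \forall w' \near w, sn w' (x w' - T) < e.

(** Near [w] a local approximant [S] of [x] changes the distance to [T] by less than [e / 4], and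
    the seminorm of the fixed element [S - T] is continuous. *)
Lemma gluing_dist_continuous T : continuous (fun w => sn w (x w - T) : R).
Proof.
move=> w; apply/cvgrPdist_lt => e e0.
have e4 : 0 < e / 4 by rewrite divr_gt0.
have [S HS] := x_local w e4.
have H0 := nbhs_singleton HS.
have H := fibre_norm_near Rr g w (S - T) e4.
apply: filterS2 HS H => w'.
have := fibre_norm_tri Rr g w (x w) S T; have := fibre_norm_tri Rr g w S (x w) T.
have := fibre_norm_tri Rr g w' (x w') S T; have := fibre_norm_tri Rr g w' S (x w') T.
rewrite (fibre_normB Rr g w S (x w)) (fibre_normB Rr g w' S (x w')).
rewrite !ltr_norml => ? ? ? ? ? /andP[? ?]; move: H0 => /= ?.
by apply/andP; split; lra.
Qed.

(* The continuous functions [max 0 (e - |x - T|)], for [T] in a finite family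
   approximating [x] everywhere, replace a partition of unity. *)
Lemma gluing_approx (e : R) : 0 < e -> exists T, forall w, sn w (x w - T) <= e.
Proof.
move=> e0.
have [s Hs] : exists s : seq (hom2 r r), forall w, [set: Omega] w ->
    has (fun T => sn w (x w - T) < e) s.
  apply: (@compact_induction _ (fun X => exists s : seq (hom2 r r),
    forall w, X w -> has (fun T => sn w (x w - T) < e) s)) => //.
  - by exists [::].
  - move=> X Y [s Hs] [t Ht]; exists (s ++ t) => w [/Hs|/Ht] H.
      by rewrite has_cat H.
    by rewrite has_cat H orbT.
  - by move=> X Y XY [s Hs]; exists s => w /XY/Hs.
  - move=> w; have [T HT] := x_local w e0.
    by exists [set w' | sn w' (x w' - T) < e] => //; exists [:: T] => w' /= ->.
pose f T w := Num.max 0 (e - sn w (x w - T)).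
have f0 T w : 0 <= f T w by rewrite le_max lexx.
have fc T : continuous (f T).
  apply: continuous_max_cst => w; apply: cvgB; first exact: cvg_cst.
  exact: gluing_dist_continuous.
pose F w := \sum_(T <- s) f T w.
have F0 w : 0 < F w.
  have /hasP[T Ts H] := Hs w I.
  rewrite /F (perm_big _ (perm_to_rem Ts)) big_cons /=.
  apply: ltr_wpDr; first by apply: sumr_ge0.
  by rewrite lt_max subr_gt0 H orbT.
have Fc : continuous F.
  rewrite /F; elim: (s) => [|T t IH] w.
    under eq_fun do rewrite big_nil; exact: cvg_cst.
  under eq_fun do rewrite big_cons.
  by apply: cvgD; [exact: fc|exact: IH].
have /choice[U HU] T : exists T', forall w, sn w (T' - (f T w / F w)%:C%C *: T) = 0.
  apply: (fibre_module hR) => w; apply: cvgM; first exact: fc.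
  by apply: cvgV; [rewrite gt_eqF|exact: Fc].
exists (\sum_(T <- s) U T) => w.
have FE : (\sum_(T <- s) f T w) / F w = 1 by exact: (divff (lt0r_neq0 (F0 w))).
have xE : x w = \sum_(T <- s) (f T w / F w)%:C%C *: x w.
  by rewrite -scaler_suml -rmorph_sum -mulr_suml FE scale1r.
rewrite {1}xE -sumrB; apply: le_trans (fibre_norm_sum_le _ _ _) _.
apply: (@le_trans _ _ (\sum_(T <- s) f T w / F w * e)); last first.
  by rewrite -!mulr_suml FE mul1r.
apply: ler_sum => T _.
have p0 : 0 <= f T w / F w by rewrite divr_ge0 // ltW.
apply: (@le_trans _ _ (f T w / F w * sn w (x w - T))).
  apply: le_trans (fibre_norm_tri Rr g w _ ((f T w / F w)%:C%C *: T) _) _.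
  rewrite -scalerBr fibre_normZ rnorm_real ger0_norm //.
  by rewrite (fibre_normB Rr g w _ (U T)) HU addr0.
(* A member of the family at distance at least [e] from [x w] has weight 0, so only close members
   contribute to the average. *)
have [H|H] := ltP (sn w (x w - T)) e; first by rewrite ler_wpM2l // ltW.
have -> : f T w = 0 by apply/max_idPl; rewrite subr_le0.
by rewrite !mul0r.
Qed.

(** Global approximants at precision [2^-1 ^+ n] are uniformly Cauchy, and [fibre_norm_complete]
    gives their limit. *)
Lemma gluing : exists T, forall w, sn w (x w - T) = 0.
Proof.
have e0 n : 0 < 2^-1 ^+ n :> R by rewrite exprn_gt0 // invr_gt0.
have /choice[T HT] n := gluing_approx (e0 n).
have [//|n w|L HL] := fibre_norm_complete (g := g) hR cO (T := T) (C := 2).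
  have := fibre_norm_tri Rr g w (T n.+1) (x w) (T n).
  have := HT n w; have := HT n.+1 w; have := e0 n.
  by rewrite (fibre_normB Rr g w (T n.+1) (x w)) exprS; lra.
exists L => w; apply/le_anti; rewrite fibre_norm_ge0 andbT.
apply: (@le_half_expr _ _ 5) => n.
have := fibre_norm_tri Rr g w (x w) (T n) L.
by have := HT n w; have := HL n w; lra.
Qed.

End gluing.

End bundle.

(** * Each fibre as a $C^*$-algebra *)

Section fibre_algebra.
Context {R : realType} {K : two_cstar_category R} {A B : obj K}.
Context {r : arr A B} {rb : arr B A}.
Variables (Rr : hom2 (unit1 A) (rb ⊙ r)) (Rrb : hom2 (unit1 B) (r ⊙ rb)).
Hypothesis hR : conjugation_equations Rr Rrb.
Context {Omega : topologicalType}.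
Hypothesis cO : compact [set: Omega].
Variables (g : gelfand_identification A Omega) (w : Omega).
Let KP := two_catP K.

Local Notation H := (end_hilbert Rr g w).

(** Since [sn] is at most [m] times the operator norm, representatives [T n] form a Cauchy sequence
    of vectors. Its limit lifts to some [L] by [to_completion_surj], and the reverse comparison
    returns to operators. *)
Lemma gns_range_complete (u : nat -> H -> H) : (forall n, range (gns Rr g w) (u n)) ->
  (forall e : R, 0 < e -> exists N, forall m n,
    (N <= m)%N -> (N <= n)%N -> opnorm (u m - u n) < e) ->
  exists2 l, range (gns Rr g w) l & (fun n => opnorm (u n - l)) @ \oo --> (0 : R).
Proof.
move=> uE uc.
have /choice[T HT] n : exists T, u n = gns Rr g w T by have [T _ <-] := uE n; exists T.
have [M M0 HM] := gns_norm_le_fibre hR cO g.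
have [m m0 Hm] := fibre_norm_le_gns hR cO g.
pose v n := to_completion (end_sip Rr g w) (T n).
have [e e0|l Hl] := complete_of_rnorm_cauchy (u := v).
  have [|N HN] := uc (e / m); first by rewrite divr_gt0.
  exists N => a b Na Nb; have := HN a b Na Nb.
  rewrite !HT -(gnsB hR cO) // ltr_pdivlMr // mulrC; apply: le_lt_trans.
  by rewrite /v -linearB rnorm_to Hm.
have [L HL] := to_completion_surj hR cO l.
exists (gns Rr g w L); first by exists L.
apply/cvgrPdist_lt => e e0; have [|N HN] := Hl (e / M); first by rewrite divr_gt0.
exists N => // n /= Nn; rewrite sub0r normrN HT -(gnsB hR cO) //.
rewrite ger0_norm; last exact: (gns_norm_ge0 hR cO).
apply: le_lt_trans (HM _ _) _; rewrite mulrC -ltr_pdivlMr //.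
by have := HN n Nn; rewrite HL /v -linearB rnorm_to.
Qed.

Lemma gns_range_banach :
  is_banach_space (V := (H -> H : lmodType R[i])) (range (gns Rr g w)) opnorm.
Proof.
split.
- by exists 0; rewrite // (gns0 hR cO).
- move=> a _ _ [S _ <-] [T _ <-]; exists (a *: S + T) => //; exact: (gnsL hR cO).
- move=> _ [T _ <-]; exact: (gns_norm_ge0 hR cO).
- move=> _ [T _ <-]; exact: (gns_norm_eq0 hR cO).
- move=> a _ [T _ <-].
  have <- : gns Rr g w (a *: T) = a *: gns Rr g w T.
    by have := gnsL hR cO g w a T 0; rewrite (gns0 hR cO) // !addr0.
  exact: (gns_normZ hR cO).
- move=> _ _ [S _ <-] [T _ <-].
  have <- : gns Rr g w (S + T) = gns Rr g w S + gns Rr g w T.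
    by have := gnsL hR cO g w 1 S T; rewrite !scale1r.
  exact: (gns_normD hR cO).
- exact: gns_range_complete.
Qed.

Lemma gns_range_cstar :
  is_cstar_algebra (V := (H -> H : lmodType R[i])) (range (gns Rr g w)) opnorm
    (fun f h => f \o h) adjoint.
Proof.
split.
- exact: gns_range_banach.
- by move=> _ _ [S _ <-] [T _ <-]; exists (S ∘ T); rewrite // (gns_comp hR cO).
- by [].
- by [].
- move=> a _ _ _ [S _ <-] [T _ <-] [U _ <-].
  apply/funext => x; exact: (gns_linear hR cO).
- by move=> _ [T _ <-]; exists T^†; rewrite // (adjoint_gns hR cO).
- by move=> _ [T _ <-]; rewrite !(adjoint_gns hR cO) // (starK KP).
- move=> a _ _ [S _ <-] [T _ <-]; rewrite -(gnsL hR cO) // !(adjoint_gns hR cO) //.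
  by rewrite (star_antilinear KP) (gnsL hR cO).
- move=> _ _ [S _ <-] [T _ <-]; rewrite (gns_comp hR cO) !(adjoint_gns hR cO).
  rewrite (gns_comp hR cO).
  by rewrite (star_vcomp KP).
- move=> _ _ [S _ <-] [T _ <-]; rewrite (gns_comp hR cO) //; exact: (gns_normM hR cO).
- move=> _ [T _ <-]; rewrite (adjoint_gns hR cO) (gns_comp hR cO).
  exact: (gns_norm_star_vcomp hR cO).
Qed.

End fibre_algebra.

(** * Assembly of the bundle *)

Theorem proposition2p7 (R : realType) (K : two_cstar_category R)
  (hproj : closed_under_projections K)
  (hsum : closed_under_direct_sums K)
  (hconj : closed_under_conjugation K)
  (A B : obj K) (r : arr A B) (rb : arr B A)
  (Rr : hom2 (unit1 A) (rb ⊙ r)) (Rrb : hom2 (unit1 B) (r ⊙ rb))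
  (hR : conjugation_equations Rr Rrb)
  (Omega : topologicalType) (hcompact : compact [set: Omega])
  (hhausdorff : hausdorff_space Omega) (g : gelfand_identification A Omega) :
  let operators w := end_hilbert Rr g w -> end_hilbert Rr g w in
  let section T : forall w, operators w := fun w => gns Rr g w T in
  is_cstar_bundle
    (fun w => operators w : lmodType R[i])
    (fun w => range (gns Rr g w))
    (fun w => opnorm)
    (range section)
    (fun w f h => f \o h)
    (fun w => adjoint) /\
  set_bij [set: hom2 r r] (range section) section.
Proof.
move=> operators section; have KP := two_catP K.
have sectionE X : (forall w, exists T, X w = gns Rr g w T) ->
    exists x : Omega -> hom2 r r, forall w, X w = gns Rr g w (x w).
  by move=> /(@choice _ _ (fun w T => X w = gns Rr g w T))[x Hx]; exists x.
split; first split; first split.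
- exact: hcompact.
- exact: hhausdorff.
- by move=> w; exact: (gns_range_banach hR hcompact).
- by move=> _ [T _ <-] w; exists T.
- by exists 0 => //; apply/functional_extensionality_dep => w; exact: (gns0 hR hcompact).
- move=> a _ _ [S _ <-] [T _ <-]; exists (a *: S + T) => //.
  by apply/functional_extensionality_dep => w; exact: (gnsL hR hcompact).
(* The fibre consists of values of sections, so the approximation error is 0. *)
- move=> w _ e [T _ <-] e0; exists (section T); first by exists T.
  have -> : gns Rr g w T - section T w = gns Rr g w 0 by rewrite subrr (gns0 hR hcompact).
  have [M _ HM] := gns_norm_le_fibre hR hcompact g.
  by apply: le_lt_trans (HM _ _) _; rewrite fibre_norm0 mulr0.
- move=> _ [T _ <-]; exact: (gns_norm_continuous hR hcompact).
- move=> X XE Xloc.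
  have [|x Hx] := sectionE X; first by move=> w; have [T _ <-] := XE w; exists T.
  have [m m0 Hm] := fibre_norm_le_gns hR hcompact g.
  (* The representatives [x w] are chosen point by point; local closeness to within [e / m] in
     operator norm makes them closer than [e] in the seminorms that [gluing] uses. *)
  have [w e e0|T HT] := gluing hR hcompact (g := g) (x := x).
    have [|_ [T _ <-] HT] := Xloc w (e / m); first by rewrite divr_gt0.
    exists T; apply: filterS HT => w'; rewrite Hx -(gnsB hR hcompact) // ltr_pdivlMr // mulrC.
    exact: le_lt_trans (Hm _ _).
  exists T => //; apply/functional_extensionality_dep => w.
  by rewrite Hx; apply/esym/(gns_congr hR hcompact).
- by move=> w; exact: (gns_range_cstar hR hcompact).
- move=> _ _ [S _ <-] [T _ <-]; exists (S ∘ T) => //.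
  by apply/functional_extensionality_dep => w; apply/esym/(gns_comp hR hcompact).
- move=> _ [T _ <-]; exists T^† => //.
  by apply/functional_extensionality_dep => w; apply/esym/(adjoint_gns hR hcompact).
split; [by move=> T _; exists T| |by []].
(* Equal operators in each fibre make every seminorm of [S - T] vanish, and the seminorms together
   separate points. *)
move=> S T _ _ ST; apply: (fibre_norm_separates hR (g := g)) => w.
have [m m0 Hm] := fibre_norm_le_gns hR hcompact g; apply/le_anti.
rewrite fibre_norm_ge0 andbT; apply: le_trans (Hm _ _) _.
have ST_w : gns Rr g w S = gns Rr g w T := congr1 (fun X => X w) ST.
rewrite /gns_norm (gnsB hR hcompact) ST_w subrr -(gns0 hR hcompact g w).
have [M _ HM] := gns_norm_le_fibre hR hcompact g.
rewrite -(mulr0 m) ler_wpM2l ?(ltW m0) //; apply: le_trans (HM _ _) _.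
by rewrite fibre_norm0 mulr0.
Qed.
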